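(* Let $\Delta\ge 2$ be an integer. Any connected component of the complement of the zero-locus, $\mathbb{C}\setminus\overline{\mathcal{Z}_\Delta}$, is simply connected.
   Context: For a finite simple graph $G=(V,E)$, the independence polynomial is $Z_G(\lambda)=\sum_{I}\lambda^{|I|}$, the sum being over all independent sets $I\subseteq V$. $\mathcal{Z}_\Delta=\{\lambda\in\mathbb{C}: Z_G(\lambda)=0\text{ for some finite simple graph }G\text{ of maximum degree at most }\Delta\}$, and $\overline{\mathcal{Z}_\Delta}$ is its closure in $\mathbb{C}$ (the zero-locus). *)

(* Defs.v *)
From HB Require Import structures.
From mathcomp Require Import all_boot all_order all_algebra.
From mathcomp Require Import complex.
From mathcomp Require Import boolp classical_sets functions reals set_interval.
From mathcomp Require Import topology normedtype.

Set Implicit Arguments.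
Unset Strict Implicit.
Unset Printing Implicit Defensive.

Import Order.TTheory GRing.Theory Num.Theory.
Import numFieldNormedType.Exports.

Local Open Scope classical_set_scope.
Local Open Scope ring_scope.

Record simple_graph := SimpleGraph {
  vertex :> finType;
  adj : rel vertex;
  adj_sym : symmetric adj;
  adj_irrefl : irreflexive adj
}.

Definition degree (G : simple_graph) (v : G) : nat := #|[set w | adj v w]%SET|.

Definition max_degree (G : simple_graph) : nat := (\max_(v : G) degree v)%N.

Definition independent (G : simple_graph) (I : {set G}) : bool :=
  [forall u in I, forall v in I, ~~ adj u v].

Definition indep_poly (C : pzRingType) (G : simple_graph) (lambda : C) : C :=
  \sum_(I : {set G} | independent I) lambda ^+ #|I|.

(* The complex plane is [R[i]^o]: the topology of the modulus is attached to
   the regular-module alias [_^o] of the field [R[i]]. *)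
Definition zeros (R : realType) (Delta : nat) : set R[i]^o :=
  [set lambda | exists2 G : simple_graph,
     (max_degree G <= Delta)%N & indep_poly G (lambda : R[i]) = 0].

Arguments zeros R Delta : clear implicits.

Definition zero_locus (R : realType) (Delta : nat) : set R[i]^o :=
  closure (zeros R Delta).
Arguments zero_locus R Delta : clear implicits.

(* Paths are total functions on R of which only the restriction to [0, 1]
   matters; likewise homotopies and [0, 1] x [0, 1]. *)
Definition is_path (R : realType) (T : topologicalType) (U : set T)
    (x y : T) (f : R -> T) : Prop :=
  [/\ {within `[0, 1], continuous f}, f 0 = x, f 1 = y &
      forall t, t \in `[0, 1] -> U (f t)].

Definition path_connected (R : realType) (T : topologicalType) (U : set T)
    : Prop :=
  forall x y, U x -> U y -> exists f : R -> T, is_path U x y f.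
Arguments path_connected R {T} U.

(* [H (s, t)] is the position at time [t] of the loop at stage [s]. *)
Definition null_homotopic (R : realType) (T : topologicalType) (U : set T)
    (x : T) (f : R -> T) : Prop :=
  exists H : R * R -> T,
    [/\ {within `[0, 1] `*` `[0, 1], continuous H},
        forall s t, s \in `[0, 1] -> t \in `[0, 1] -> U (H (s, t)),
        forall t, t \in `[0, 1] -> H (0, t) = f t,
        forall t, t \in `[0, 1] -> H (1, t) = x &
        forall s, s \in `[0, 1] -> H (s, 0) = x /\ H (s, 1) = x].

Definition simply_connected (R : realType) (T : topologicalType) (U : set T)
    : Prop :=
  [/\ U !=set0, path_connected R U &
      forall (x : T) (f : R -> T), is_path U x x f -> null_homotopic U x f].
Arguments simply_connected R {T} U.

(* Main.v *)
(* Trees suffice: by the recursion of the self-avoiding walk tree, a zero of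
   Z_G is a zero of Z_T for a tree T with the same degree bound.

   Let Omega be the complement of the zero locus. If T is a tree whose root v
   has degree less than Delta, hanging T on every vertex of a path gives
   caterpillars whose polynomials vanish where
   Z_T + 4 cos^2(theta) lambda Z_{T - v} does, for a dense set of angles. As
   roots of polynomials persist, Z_T + c lambda Z_{T - v} has no root in Omega
   for any c in [0, 4].

   Let K be compact, with every point of K in Omega or interior to K. If Z_T has
   no root in K, then neither has Z_T + c lambda Z_{T - v} for c in [0, 4]: the
   set of bad c is closed by compactness, and open because the roots in K are
   interior. Taking c = 1 adds a leaf to T, so by induction no tree has a root in
   K, and K is contained in Omega: Omega has no holes.

   A loop in Omega is homotopic to a closed walk on a fine lattice. The walk is
   contracted by removing the subloops at repeated vertices; once it has none,
   the vertex farthest from the base point in the l^1 distance is a corner of a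
   cell enclosed by the walk an odd number of times. The union of these cells
   has its boundary on the walk, so it lies in Omega, and the corner can be
   pushed across its cell. For Delta = 2 all trees are paths and their roots are
   computed directly. *)
Require Import Defs.
From HB Require Import structures.
From mathcomp Require Import all_boot all_order all_algebra.
From mathcomp Require Import complex ring lra zify.
From mathcomp Require Import boolp classical_sets functions reals set_interval.
From mathcomp Require Import topology normedtype trigo.
Set Implicit Arguments.
Unset Strict Implicit.
Unset Printing Implicit Defensive.
Import Order.TTheory GRing.Theory Num.Theory.
Import numFieldNormedType.Exports.
Local Open Scope classical_set_scope.
Local Open Scope ring_scope.

(** * Rooted trees and their independence polynomials *)

(* [Link a b] adds the root of [b] as a new child of the root of [a]; [rdeg]
   counts the children of the root. *)
Inductive rtree := Single | Link (a b : rtree).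

Fixpoint rdeg t := if t is Link a _ then (rdeg a).+1 else 0%N.

Fixpoint tree_size t := if t is Link a b then (tree_size a + tree_size b)%N else 1%N.

(** Both roots must have degree below [D] before each joining, so that every vertex of the finished
    tree has degree at most [D]. *)
Fixpoint valid (D : nat) t :=
  if t is Link a b then
    [&& valid D a, valid D b, (rdeg a < D)%N & (rdeg b < D)%N]
  else true.

Section TreePoly.
Variables (C : comNzRingType).

(* The independence polynomials, at [x], of the tree and of the tree without
   its root. *)
Fixpoint ztree_pair (x : C) t : C * C :=
  if t is Link a b then
    let: (za, da) := ztree_pair x a in
    let: (zb, db) := ztree_pair x b in
    (za * db + da * zb - da * db, da * zb)
  else (1 + x, 1).

Definition ztree x t := (ztree_pair x t).1.
Definition zdel x t := (ztree_pair x t).2.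

Lemma ztree_Single x : ztree x Single = 1 + x. Proof. by []. Qed.
Lemma zdel_Single x : zdel x Single = 1. Proof. by []. Qed.

Lemma ztree_Link x a b : ztree x (Link a b) =
  ztree x a * zdel x b + zdel x a * ztree x b - zdel x a * zdel x b.
Proof.
by rewrite /ztree /zdel /=; case: ztree_pair => ? ?; case: ztree_pair.
Qed.

Lemma zdel_Link x a b : zdel x (Link a b) = zdel x a * ztree x b.
Proof.
by rewrite /ztree /zdel /=; case: ztree_pair => ? ?; case: ztree_pair.
Qed.

Lemma ztree_leaf x t : ztree x (Link Single t) = ztree x t + x * zdel x t.
Proof. by rewrite ztree_Link ztree_Single zdel_Single; ring. Qed.

(** The polynomial does not depend on the root, and [Link (Link a b) t2] and [Link b (Link a t2)]
    describe the same tree. Moving the root repeatedly to its last child ends at a leaf, so every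
    tree with an edge is a smaller tree with a leaf attached to its root. *)
Lemma ztree_reroot D t1 t2 : valid D (Link t1 t2) ->
  exists t, [/\ valid D (Link Single t), (tree_size t).+1 = tree_size (Link t1 t2) &
    forall x, ztree x (Link t1 t2) = ztree x (Link Single t)].
Proof.
elim: t1 t2 => [|a _ b IHb] t2; first by exists t2.
move=> /= /and4P[/and4P[va vb da db] v2 da1 d2].
have [|t [vt st zt]] := IHb (Link a t2).
  by rewrite /= va vb v2 da d2 da1 db.
exists t; split=> //; first by move: st => /=; lia.
by move=> x; rewrite -zt !(ztree_Link, zdel_Link); ring.
Qed.

End TreePoly.

Lemma horner_ztree (C : comNzRingType) (x : C) t :
  (ztree 'X t).[x] = ztree x t /\ (zdel 'X t).[x] = zdel x t.
Proof.
elim: t => [|a [za da] b [zb db]].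
  by rewrite !ztree_Single !zdel_Single !hornerE.
by rewrite !ztree_Link !zdel_Link !hornerE za da zb db.
Qed.

(** * Sums over independent sets, and the joining of two graphs by an edge *)

Section IndepSums.
Variables (C : comNzRingType) (x : C).

Definition indep_in (G : simple_graph) (P : pred {set G}) : C :=
  \sum_(I : {set G} | independent I && P I) x ^+ #|I|.

Lemma indep_inT (G : simple_graph) : indep_in (fun _ : {set G} => true) = indep_poly G x.
Proof. by apply: eq_bigl => I; rewrite andbT. Qed.

Lemma indep_in_split (G : simple_graph) (Q P : pred {set G}) : indep_in P =
  indep_in (fun I => P I && Q I) + indep_in (fun I => P I && ~~ Q I).
Proof.
rewrite /indep_in (bigID Q) /=; congr (_ + _); apply: eq_bigl => I;
by rewrite andbA.
Qed.

Section LinkGraph.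
Variables (G H : simple_graph) (v : G) (w : H).

Definition link_adj : rel (G + H)%type := fun p q =>
  match p, q with
  | inl a, inl b => adj a b
  | inr a, inr b => adj a b
  | inl a, inr b => (a == v) && (b == w)
  | inr b, inl a => (a == v) && (b == w)
  end.

Lemma link_adj_sym : symmetric link_adj.
Proof. by move=> [a|a] [b|b] //=; rewrite adj_sym. Qed.

Lemma link_adj_irrefl : irreflexive link_adj.
Proof. by move=> [a|a] /=; rewrite adj_irrefl. Qed.

Definition link_graph := SimpleGraph link_adj_sym link_adj_irrefl.

Definition join_set (p : {set G} * {set H}) : {set link_graph} :=
  (inl @: p.1 :|: inr @: p.2)%SET.
Definition split_set (I : {set link_graph}) : {set G} * {set H} :=
  ([set a | inl a \in I]%SET, [set b | inr b \in I]%SET).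

Lemma inl_join p a : ((inl a : link_graph) \in join_set p) = (a \in p.1).
Proof.
rewrite inE mem_imset; last by move=> ? ? [].
by rewrite [X in _ || X](_ : _ = false) ?orbF //; apply/imsetP => -[].
Qed.

Lemma inr_join p b : ((inr b : link_graph) \in join_set p) = (b \in p.2).
Proof.
rewrite inE orbC mem_imset; last by move=> ? ? [].
by rewrite [X in _ || X](_ : _ = false) ?orbF //; apply/imsetP => -[].
Qed.

Lemma join_setK : cancel join_set split_set.
Proof.
move=> [I J]; congr (_, _); apply/setP => a; rewrite inE;
  by rewrite ?inl_join ?inr_join.
Qed.

Lemma split_setK : cancel split_set join_set.
Proof. by move=> I; apply/setP => -[a|a]; rewrite ?inl_join ?inr_join inE. Qed.

Lemma card_join p : #|join_set p| = (#|p.1| + #|p.2|)%N.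
Proof.
rewrite cardsU card_imset ?card_imset; try by move=> ? ? [].
rewrite (_ : (_ :&: _)%SET = finset.set0) ?cards0 ?subn0 //; apply/setP => -[a|a].
  by rewrite !inE andbC; case: imsetP => // -[].
by rewrite !inE; case: imsetP => // -[].
Qed.

Lemma independent_join p : independent (join_set p) =
  [&& independent p.1, independent p.2 & ~~ ((v \in p.1) && (w \in p.2))].
Proof.
apply/forall_inP/and3P => [h|[h1 h2 h3] [a|a]].
- split.
  + apply/forall_inP => a ap; apply/forall_inP => b bp.
    have := h (inl a); rewrite inl_join => /(_ ap)/forall_inP/(_ (inl b)).
    by rewrite inl_join => /(_ bp).
  + apply/forall_inP => a ap; apply/forall_inP => b bp.
    have := h (inr a); rewrite inr_join => /(_ ap)/forall_inP/(_ (inr b)).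
    by rewrite inr_join => /(_ bp).
  + apply/negP => /andP[vp wp].
    have := h (inl v); rewrite inl_join => /(_ vp)/forall_inP/(_ (inr w)).
    by rewrite inr_join /= !eqxx => /(_ wp).
- rewrite inl_join => ap; apply/forall_inP => -[b|b].
    by rewrite inl_join => bp; move/forall_inP/(_ _ ap)/forall_inP/(_ _ bp): h1.
  rewrite inr_join => bp /=; apply: contra h3 => /andP[/eqP<- /eqP<-].
  by rewrite ap.
- rewrite inr_join => ap; apply/forall_inP => -[b|b].
    rewrite inl_join => bp /=; apply: contra h3 => /andP[/eqP<- /eqP<-].
    by rewrite ap bp.
  by rewrite inr_join => bp; move/forall_inP/(_ _ ap)/forall_inP/(_ _ bp): h2.
Qed.

(** Subsets of the joined graph are pairs of subsets and their weights multiply, so the sum factors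
    once the condition decides how the edge between [v] and [w] is avoided. *)
Lemma indep_in_link (P : pred {set link_graph}) (P1 : pred {set G})
    (P2 : pred {set H}) :
  (forall p, independent (join_set p) && P (join_set p) =
    (independent p.1 && P1 p.1) && (independent p.2 && P2 p.2)) ->
  indep_in P = indep_in P1 * indep_in P2.
Proof.
move=> hP; rewrite /indep_in (reindex join_set); last first.
  by exists split_set => I _; rewrite ?join_setK ?split_setK.
rewrite (eq_bigl _ _ hP) big_distrlr /= pair_big /=.
by apply: eq_bigr => p _; rewrite card_join exprD.
Qed.

Lemma degree_inl a :
  degree (inl a : link_graph) = (degree a + (a == v))%N.
Proof.
rewrite /degree (_ : [set _ | _]%SET =
   join_set ([set b | adj a b], [set b | (a == v) && (b == w)]))%SET.
  rewrite card_join /=; congr (_ + _)%N.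
  case: (a == v); last by apply/eqP; rewrite cards_eq0; apply/eqP/setP => b; rewrite !inE.
  by rewrite -[RHS](cards1 w); apply: eq_card => b; rewrite !inE.
by apply/setP => -[b|b]; rewrite ?inl_join ?inr_join !inE.
Qed.

Lemma degree_inr b :
  degree (inr b : link_graph) = (degree b + (b == w))%N.
Proof.
rewrite /degree (_ : [set _ | _]%SET =
   join_set ([set a | (a == v) && (b == w)], [set a | adj b a]))%SET.
  rewrite card_join /= addnC; congr (_ + _)%N.
  case: (b == w); last by apply/eqP; rewrite cards_eq0; apply/eqP/setP => a; rewrite !inE andbF.
  by rewrite -[RHS](cards1 v); apply: eq_card => a; rewrite !inE andbT.
by apply/setP => -[a|a]; rewrite ?inl_join ?inr_join !inE.
Qed.

End LinkGraph.

Definition unit_graph : simple_graph.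
Proof.
by apply: (@SimpleGraph unit (fun _ _ => false)) => //.
Defined.

Lemma tree_graph D t : valid D t -> exists (G : simple_graph) (v : G),
  [/\ (max_degree G <= D)%N, degree v = rdeg t, indep_poly G x = ztree x t
    & indep_in (fun I : {set G} => v \notin I) = zdel x t].
Proof.
have deg0 (u : unit_graph) : degree u = 0%N.
  by apply/eqP; rewrite cards_eq0; apply/eqP/setP => b; rewrite !inE.
have ind (I : {set unit_graph}) : independent I.
  by apply/forall_inP => a _; apply/forall_inP => b _.
elim: t => [_|a IHa b IHb /= /and4P[/IHa[G [v [mG dv zG oG]]]
  /IHb[H [w [mH dw zH oH]]] da db]].
  exists unit_graph, tt; split; rewrite ?deg0 //.
  - by apply/bigmax_leqP => u _; rewrite deg0.
  - rewrite -indep_inT (indep_in_split (fun I : {set unit_graph} => (tt : unit_graph) \in I)) addrC; congr (_ + _).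
      rewrite /indep_in (big_pred1 finset.set0) ?cards0 // => I; rewrite ind /=.
      by apply/idP/eqP => [h|->]; rewrite ?inE //; apply/setP => -[];
        rewrite inE; apply/negbTE.
    rewrite /indep_in (big_pred1 [set: _]%SET) ?cardsT ?card_unit // => I; rewrite ind /=.
    by apply/idP/eqP => [h|->]; rewrite ?inE //; apply/setP => -[]; rewrite inE.
  - rewrite /indep_in (big_pred1 finset.set0) ?cards0 // => I; rewrite ind /=.
    by apply/idP/eqP => [h|->]; rewrite ?inE //; apply/setP => -[];
      rewrite inE; apply/negbTE.
exists (link_graph v w), (inl v); split.
- apply/bigmax_leqP => -[u|u] _; rewrite ?degree_inl ?degree_inr.
    case: eqP => [->|_]; first by rewrite dv addn1.
    by rewrite addn0; exact: leq_trans (leq_bigmax u) mG.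
  case: eqP => [->|_]; first by rewrite dw addn1.
  by rewrite addn0; exact: leq_trans (leq_bigmax u) mH.
- by rewrite degree_inl eqxx dv addn1.
(* If the root [v] is chosen then [w] is excluded; if not, the choice in [H] is free. Each case is a
   product. *)
- rewrite -indep_inT (indep_in_split (fun I : {set link_graph v w} => (inl v : link_graph v w) \in I)).
  rewrite (@indep_in_link _ _ v w _ (fun I : {set G} => v \in I) (fun I : {set H} => w \notin I)).
  rewrite (@indep_in_link _ _ v w _ (fun I : {set G} => v \notin I) (fun _ => true)).
  + rewrite oG oH indep_inT zH ztree_Link -zG -oG -indep_inT.
    rewrite [indep_in (fun _ => true)](indep_in_split (fun I : {set G} => v \in I)) /=; ring.
  + move=> p; rewrite independent_join inl_join /=.
    by case: (v \in p.1) => //=; rewrite ?andbF ?andbT.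
  + move=> p; rewrite independent_join inl_join /=.
    by case: (v \in p.1) => //=; rewrite ?andbF ?andbT // -andbA.
- rewrite (@indep_in_link _ _ v w _ (fun I : {set G} => v \notin I) (fun _ => true)).
    by rewrite oG indep_inT zH zdel_Link.
  move=> p; rewrite independent_join inl_join /=.
  by case: (v \in p.1) => //=; rewrite ?andbF ?andbT.
Qed.

End IndepSums.

(** * Reduction of graphs to trees *)

Section SelfAvoidingWalkTree.
Variables (K : fieldType) (x : K) (D : nat) (G : simple_graph).
Hypothesis maxG : (max_degree G <= D)%N.
Hypothesis tree_neq0 : forall t, valid D t -> (rdeg t <= D)%N -> ztree x t != 0.

Let N (v : G) := [set w | adj v w]%SET.
Let zin (S : {set G}) : K := indep_in x (fun I => I \subset S).

Lemma independentU1 v (I : {set G}) : v \notin I ->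
  independent (v |: I)%SET = independent I && [disjoint I & N v].
Proof.
move=> vI; apply/forall_inP/andP => [h|[/forall_inP h1 h2] a].
  split.
    apply/forall_inP => a aI; apply/forall_inP => b bI.
    have /forall_inP := h a (finset.setU1r _ aI); apply; exact: finset.setU1r.
  rewrite disjoint_subset; apply/fintype.subsetP => b bI; rewrite !inE.
  by have /forall_inP := h v (finset.setU11 _ _); apply; exact: finset.setU1r.
have nadj b : b \in I -> ~~ adj v b.
  by move=> bI; move: h2; rewrite disjoint_subset => /fintype.subsetP/(_ _ bI); rewrite !inE.
rewrite !inE => /predU1P[->|aI]; apply/forall_inP => b; rewrite !inE => /predU1P[->|bI].
- by rewrite adj_irrefl.
- exact: nadj.
- by rewrite adj_sym nadj.
- by have /forall_inP := h1 a aI; apply.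
Qed.

(** The deletion recursion: an independent set avoids [v], or consists of [v] and an independent set
    avoiding [v] and its neighbours. *)
Lemma indep_in_vertex (S : {set G}) v : v \in S ->
  zin S = zin (S :\ v)%SET + x * zin ((S :\ v) :\: N v)%SET.
Proof.
move=> vS; rewrite /zin (indep_in_split _ (fun I : {set G} => v \notin I)).
congr (_ + _).
  rewrite /indep_in; apply: eq_bigl => I; rewrite finset.subsetD1; by case: (_ \subset _).
rewrite /indep_in big_distrr /=.
rewrite (reindex_onto (fun I => v |: I)%SET (fun I => I :\ v)%SET) /=; last first.
  by move=> I; rewrite negbK => /and3P[_ _ vI]; rewrite finset.setD1K.
apply: eq_big => [I|I].
  have [vI|vI] := boolP (v \in I).
    rewrite [_ == _](_ : _ = false) ?andbF; last first.
      by apply/eqP => /setP/(_ v); rewrite vI !inE eqxx.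
    by rewrite [_ \subset _](_ : _ = false) ?andbF //;
      apply/fintype.subsetP => /(_ _ vI); rewrite !inE eqxx andbF.
  rewrite finset.setU1K // eqxx andbT !inE eqxx /= andbT finset.subUset finset.sub1set vS /=.
  rewrite finset.subsetD finset.subsetD1 vI andbT independentU1 // andbAC -!andbA.
  by congr (_ && _); rewrite andbC.
by move=> /andP[_ /eqP vI]; rewrite cardsU1 -{1}vI !inE eqxx exprS.
Qed.

(* The child of [v] standing for a neighbour [u] explores the graph from which
   [v] and the neighbours treated before [u] have been deleted, so that the
   ratios of consecutive deletions telescope. *)
Lemma saw_attach (S : {set G}) v (s : seq G) :
  (forall S' : {set G}, (#|S'| < #|S|)%N -> zin S' != 0 /\
     forall u, u \in S' -> exists t, [/\ valid D t, (rdeg t <= #|S' :&: N u|)%N &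
       ztree x t * zin (S' :\ u)%SET = zdel x t * zin S']) ->
  v \in S -> uniq s -> {subset s <= (S :\ v) :&: N v}%SET ->
  exists t, [/\ valid D t, rdeg t = size s &
   (ztree x t - zdel x t) * zin (S :\ v)%SET =
   zdel x t * x * zin ((S :\ v) :\: [set u in s])%SET].
Proof.
move=> IH vS; elim: s => [_ _|u s IHs /= /andP[us uns] sub].
  exists Single; split=> //; rewrite ztree_Single zdel_Single.
  by rewrite (_ : [set u in [::]] = finset.set0)%SET ?finset.setD0; [ring|apply/setP => u; rewrite !inE].
have [|t [vt dt et]] := IHs uns; first by move=> z zs; apply: sub; rewrite inE zs orbT.
set S' := ((S :\ v) :\: [set u in s])%SET in et.
have := sub u (mem_head _ _); rewrite !inE => /andP[/andP[uv uS] vu].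
have uS' : u \in S' by rewrite !inE us uv.
have vS' : v \notin S' by rewrite !inE eqxx /= andbF.
have [|_ /(_ u uS')[t' [vt' dt' et']]] := IH S'.
  apply: proper_card; apply/properP; split; last by exists v.
  by apply/fintype.subsetP => z; rewrite !inE => /and3P[].
(* The neighbour [v] of [u] lies outside [S'], so the root of [t'] has room for the edge to its
   parent. *)
have dD : (rdeg t' < D)%N.
  apply: leq_trans (leq_trans (leq_bigmax u) maxG).
  apply: leq_ltn_trans dt' (proper_card _); apply/properP; split.
    by apply/fintype.subsetP => z; rewrite !inE => /andP[].
  by exists v; rewrite !inE ?eqxx ?andbF // adj_sym.
have dD' : (rdeg t < D)%N.
  rewrite dt; apply: leq_trans (leq_trans (leq_bigmax v) maxG).
  rewrite -(card_uniqP uns); apply: proper_card; apply/properP; split.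
    by apply/fintype.subsetP => z zs; have := sub z; rewrite !inE zs orbT => /(_ isT)/andP[].
  by exists u; rewrite ?inE.
exists (Link t t'); split; rewrite /= ?vt ?vt' ?dD ?dD' ?dt //.
rewrite ztree_Link zdel_Link.
rewrite (_ : (_ :\: [set z in u :: s])%SET = (S' :\ u)%SET); last first.
  by apply/setP => z; rewrite !inE negb_or -!andbA.
transitivity (zdel x t' * ((ztree x t - zdel x t) * zin (S :\ v)%SET)); first by ring.
rewrite et; transitivity (zdel x t * x * (zdel x t' * zin S')); first by ring.
by rewrite -et'; ring.
Qed.

(** Both claims are proved together by induction on the size of [S]. The ratio is stated without
    division, hence before [zin S] is known to be nonzero; a zero of [zin S] would then kill
    [ztree x t * zin (S :\ v)], whose factors are both nonzero. *)
Lemma saw_ratio (S : {set G}) : zin S != 0 /\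
  forall v, v \in S -> exists t, [/\ valid D t, (rdeg t <= #|S :&: N v|)%N &
    ztree x t * zin (S :\ v)%SET = zdel x t * zin S].
Proof.
have [n] := ubnP #|S|; elim: n S => // n IHn S cS.
have ratio v : v \in S -> exists t, [/\ valid D t, (rdeg t <= #|S :&: N v|)%N &
    ztree x t * zin (S :\ v)%SET = zdel x t * zin S].
  move=> vS; have [||t [vt dt et]] := @saw_attach S v (enum ((S :\ v) :&: N v)%SET) _ vS (enum_uniq _).
  - by move=> S' cS'; apply: IHn; apply: leq_trans cS' _.
  - by move=> z; rewrite mem_enum.
  exists t; split=> //.
    rewrite dt -cardE subset_leq_card //; apply/fintype.subsetP => z.
    by rewrite !inE => /andP[/andP[_ ->]].
  rewrite (indep_in_vertex vS); apply/eqP; rewrite mulrDr addrC -subr_eq -mulrBl; apply/eqP.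
  rewrite et -mulrA; congr (_ * (_ * zin _)); apply/setP => z; rewrite !inE mem_enum !inE.
  by case: (z == v); case: (z \in S); case: (adj v z).
split=> //; have [->|[v vS]] := set_0Vmem S.
  rewrite /zin /indep_in (big_pred1 finset.set0) ?cards0 ?oner_eq0 // => I.
  rewrite finset.subset0 /= andbC; case: (I =P finset.set0) => [->|_] /=; last by [].
  by apply/forall_inP => a; rewrite inE.
have [t [vt dt et]] := ratio v vS.
have [z0 _] : zin (S :\ v)%SET != 0 /\ True.
  by split=> //; case: (IHn (S :\ v)%SET) => //; move: cS; rewrite (cardsD1 v) vS.
have /tree_neq0 : valid D t by [].
have dD : (rdeg t <= D)%N.
  apply: leq_trans dt (leq_trans _ (leq_trans (leq_bigmax v) maxG)).
  by apply/subset_leq_card/fintype.subsetP => z; rewrite !inE => /andP[].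
move=> /(_ dD) zt; apply/eqP => zS.
by move/eqP: et; rewrite zS mulr0 mulf_eq0 (negbTE zt) (negbTE z0).
Qed.

End SelfAvoidingWalkTree.

Lemma indep_poly_tree (K : fieldType) (x : K) (D : nat) (G : simple_graph) :
  (max_degree G <= D)%N -> indep_poly G x = 0 ->
  exists2 t, valid D t & ztree x t = 0.
Proof.
move=> mG zG; apply: contrapT => nt.
have [] := @saw_ratio K x D G mG _ [set: G]%SET.
  by move=> t vt _; apply/eqP => zt; apply: nt; exists t.
rewrite -[X in X = 0]indep_inT in zG; rewrite (_ : indep_in _ _ = 0) ?eqxx // -[RHS]zG.
by apply: eq_bigl => I; rewrite finset.subsetT.
Qed.

(** * Persistence of roots *)

Section Hurwitz.
Variable K : numClosedFieldType.
Implicit Types (p P Q : {poly K}).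

(** Every root [a] has distance at least [r] from [z0], so each linear factor grows from [z0] to [w]
    by at most the factor [1 + |w - z0| / r]. The bound depends on [p] only through its degree. *)
Lemma zero_free_growth p n (z0 w r : K) : 0 < r -> (size p <= n.+1)%N ->
  (forall z, `|z0 - z| < r -> p.[z] != 0) ->
  `|p.[w]| <= `|p.[z0]| * (1 + `|w - z0| / r) ^+ n.
Proof.
move=> r0 sp nz; have [s ps] := closed_field_poly_normal p.
have [p0|p0] := eqVneq p 0; first by rewrite p0 !horner0 normr0 mul0r.
have ss : (size s <= n)%N.
  by move: sp; rewrite ps size_scale ?lead_coef_eq0 // size_prod_XsubC.
have m1 : 1 <= 1 + `|w - z0| / r by rewrite lerDl divr_ge0 // ltW.
have far a : a \in s -> r <= `|z0 - a|.
  move=> sa; rewrite real_leNgt ?ger0_real ?(ltW r0) //; apply/negP => /nz.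
  by rewrite ps hornerZ mulf_eq0 negb_or -/(root _ _) root_prod_XsubC sa andbF.
rewrite ps !hornerZ !normrM -mulrA ler_wpM2l //.
apply: (@le_trans _ _ (`|(\prod_(z <- s) ('X - z%:P)).[z0]| * (1 + `|w - z0| / r) ^+ size s));
  last by rewrite ler_wpM2l // ler_weXn2l.
elim: s far {ps ss} => [_|a s IH far]; first by rewrite !big_nil /= expr0 mulr1 !hornerE.
rewrite !big_cons !hornerM !hornerXsubC !normrM exprS mulrACA.
rewrite ler_pM //; last by apply: IH => b bs; apply: far; rewrite inE bs orbT.
have ra : r <= `|z0 - a| by apply: far; rewrite inE eqxx.
rewrite mulrDr mulr1 (_ : w - a = (z0 - a) + (w - z0)); last by ring.
apply: le_trans (ler_normD _ _) _; rewrite lerD2l.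
by rewrite mulrCA ler_peMr // ler_pdivlMr // mul1r.
Qed.

(* Otherwise [zero_free_growth] would bound the nonzero value at [w] by a fixed
   multiple of the value at [z0], which tends to 0 as [c'] tends to [c]. *)
Lemma root_persistence P Q (c z0 w r : K) : 0 < r ->
  (P + c *: Q).[z0] = 0 -> (P + c *: Q).[w] != 0 ->
  exists2 d, 0 < d &
    forall c', `|c' - c| < d -> exists2 z, `|z0 - z| < r & (P + c' *: Q).[z] = 0.
Proof.
move=> r0 F0 Fw; pose n := maxn (size P) (size Q).
pose M : K := (1 + `|w - z0| / r) ^+ n.
have M0 : 0 <= M by rewrite exprn_ge0 // addr_ge0 // divr_ge0 // ltW.
(* Without a root near [z0], the growth bound would give [|(P + c Q)(w)| <= |c' - c| A]. The summand
   1 keeps the divisor positive. *)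
pose A : K := `|Q.[z0]| * M + `|Q.[w]| + 1.
have A0 : 0 < A by rewrite ltr_wpDl // addr_ge0 // mulr_ge0.
exists (`|(P + c *: Q).[w]| / A) => [|c' cc]; first by rewrite divr_gt0 ?normr_gt0.
apply: contrapT => nz; move: cc; rewrite ltr_pdivlMr // => cc.
have Fc' z : (P + c' *: Q).[z] = (P + c *: Q).[z] + (c' - c) * Q.[z].
  by rewrite !hornerE; ring.
have := @zero_free_growth (P + c' *: Q) n z0 w r r0.
rewrite (leq_trans (size_polyD _ _)); last first.
  rewrite geq_max (leq_trans (leq_maxl _ _) (leqnSn _)) /=.
  by rewrite (leq_trans (size_scale_leq _ _)) // (leq_trans (leq_maxr _ _) (leqnSn _)).
have Fnz z : `|z0 - z| < r -> (P + c' *: Q).[z] != 0.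
  by move=> zr; apply/eqP => Fz; apply: nz; exists z.
move=> /(_ isT Fnz).
apply/negP; rewrite -real_ltNge; last 2 first.
- by rewrite realM // ger0_real.
- by rewrite normr_real.
rewrite !Fc' F0 add0r normrM -/M.
have := lerB_normD (P + c *: Q).[w] ((c' - c) * Q.[w]).
apply: lt_le_trans; rewrite ltrBrDr normrM -mulrA -mulrDr.
apply: le_lt_trans cc; rewrite ler_wpM2l // /A lerDl //.
Qed.

End Hurwitz.

(** * Paths and caterpillars *)

(** A spine of [n.+1] new vertices, each joined to the root of its own copy of [t]. Inner spine
    vertices have degree 3. *)
Fixpoint caterpillar t n :=
  if n is m.+1 then Link (Link Single t) (caterpillar t m) else Link Single t.

Lemma valid_caterpillar D t n : (3 <= D)%N -> valid D t -> (rdeg t < D)%N ->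
  valid D (caterpillar t n).
Proof.
move=> D3 vt dt; have [D0 D1 D2] : [/\ 0 < D, 1 < D & 2 < D]%N by split; lia.
have dc m : (rdeg (caterpillar t m) < D)%N by case: m.
by elim: n => [|n IH] /=; rewrite vt dt D0 ?D1 ?dc ?IH.
Qed.

Fixpoint path_tree n := if n is m.+1 then Link Single (path_tree m) else Single.

Lemma valid_path_tree D n : (2 <= D)%N -> valid D (path_tree n).
Proof.
move=> D2; elim: n => //= n ->; rewrite (ltnW D2) /=.
by apply: leq_trans D2; case: n.
Qed.

(** Eliminating [B] gives [A n.+2 = b * A n.+1 + e * b * A n]. For [b = - 4 cos^2(theta) e] the
    characteristic roots are [- 2 e cos(theta)] times the exponentials of [i theta] and [- i theta],
    whence the factor [sin((n + 3) theta) / sin(theta)]; the shift by 3 comes from the initial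
    values. Multiplying by the sine avoids division in [K]. *)
Lemma path_transfer (R : realType) (K : comNzRingType) (f : {rmorphism R -> K})
  (th : R) (b e : K) (A B : nat -> K) :
  b + f (4 * cos th ^+ 2) * e = 0 ->
  A 0%N = b + e -> B 0%N = b ->
  (forall n, A n.+1 = b * A n + e * B n) -> (forall n, B n.+1 = b * A n) ->
  forall n, A n * f (sin th) =
    (- e) ^+ n.+1 * f (2 * cos th) ^+ n * f (sin (n.+3%:R * th)).
Proof.
move=> bE A0 B0 AS BS; set C := f (2 * cos th).
have {}bE : b = C ^+ 2 * - e.
  by apply/eqP; rewrite mulrN -addr_eq0 -[X in _ == X]bE /C -rmorphXn exprMn -natrX.
have sinS n : sin (n.+2%:R * th) = 2 * cos th * sin (n.+1%:R * th) - sin (n%:R * th).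
  have -> : n.+2%:R * th = n.+1%:R * th + th by rewrite -addn1 natrD; ring.
  have -> : n%:R * th = n.+1%:R * th - th by rewrite -addn1 natrD; ring.
  by rewrite sinD sinB; ring.
have s2 : sin (2%:R * th) = 2 * cos th * sin th.
  by rewrite sinS mul1r mul0r sin0 subr0.
have s3 : f (sin (3%:R * th)) = (C ^+ 2 - 1) * f (sin th).
  by rewrite sinS s2 mul1r rmorphB /C !rmorphM; ring.
suff AB n : A n * f (sin th) = (- e) ^+ n.+1 * C ^+ n * f (sin (n.+3%:R * th)) /\
    B n * f (sin th) = (- e) ^+ n.+1 * C ^+ n.+1 * f (sin (n.+2%:R * th)).
  by move=> n; case: (AB n).
elim: n => [|n [IHA IHB]].
  split; first by rewrite A0 s3 bE; ring.
  by rewrite B0 s2 bE rmorphM -/C; ring.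
split; last by rewrite BS -mulrA IHA bE !(exprS _ n.+1) !(exprS _ n); ring.
rewrite (sinS n.+2) rmorphB rmorphM -/C AS mulrDl -(mulrA b) -(mulrA e) IHA IHB bE !(exprS _ n.+1) !(exprS _ n); ring.
Qed.

(** * Density of the parameters 4 cos^2(theta) *)

Section CosDensity.
Variable R : realType.

(** Write [c = 4 cos^2(t0)] with [t0] in [[0, pi / 2]] and take for [th] the first multiple of
    [pi / (n + 3)] above [t0], with [n] large. As the mesh is at most [pi / 3], [th] lies strictly
    between 0 and [pi], where the sine is nonzero. *)
Lemma four_cos_sqr_dense (c d : R) : 0 <= c <= 4 -> 0 < d -> exists (n : nat) (th : R),
  [/\ `|4 * cos th ^+ 2 - c| < d, sin th != 0 & sin (n.+3%:R * th) = 0].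
Proof.
move=> /andP[c0 c4] d0; pose s := Num.sqrt c / 2.
have s0 : 0 <= s by rewrite divr_ge0 ?sqrtr_ge0.
have cs : c = 4 * s ^+ 2 by rewrite exprMn sqr_sqrtr // exprVn; field.
have s1 : s <= 1 by rewrite -(@expr_le1 _ 2%N) //; lra.
have sI : -1 <= s <= 1 by rewrite s1 andbT; lra.
pose t0 := acos s.
have ct0 : cos t0 = s by rewrite acosK // in_itv /=.
have t0_ge0 : 0 <= t0 by exact: acos_ge0.
have t0_le : t0 <= pi / 2.
  rewrite leNgt -(@ltr_cos R) ?cos_pihalf ?ct0 -?leNgt // in_itv /=.
    have := pi_gt0 R; lra.
  by rewrite t0_ge0 acos_lepi.
have : continuous (fun t : R => 4 * cos t ^+ 2).
  by move=> t; apply: cvgM; [exact: cvg_cst|apply: cvgM; exact: continuous_cos].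
move=> /(_ t0); rewrite /continuous_at ct0 -cs => /cvgrPdist_lt /(_ d d0).
move=> /nbhs_ballP[r /= r0 rd].
have pi0 := pi_gt0 R; pose n := Num.truncn (2 * pi / r + 3).
have hn : pi / (n.+3%:R) < r.
  rewrite ltr_pdivrMr // -ltr_pdivrMl // mulrC.
  have : 2 * pi / r + 3 < n.+1%:R by apply: truncnS_gt.
  rewrite -addn2 natrD; have : 0 < pi / r by rewrite divr_gt0. 
  rewrite -mulrA; lra.
pose m : R := n.+3%:R; have m3 : 3 <= m by rewrite ler_nat.
have m0 : 0 < m by lra.
pose k := Num.truncn (m * t0 / pi).
have x0 : 0 <= m * t0 / pi by rewrite divr_ge0 ?mulr_ge0 // ltW.
have /andP[k1 k2] := truncn_itv x0.
set x := m * t0 / pi in x0 k1 k2.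
pose a := pi / m; have a0 : 0 < a by rewrite divr_gt0.
have tx : t0 = x * a by rewrite /x /a mulrA divfK ?gt_eqF // mulrC mulKf ?gt_eqF.
have k1' : k.+1%:R <= x + 1 by rewrite -addn1 natrD lerD2r.
have y1 : t0 < k.+1%:R * a by rewrite {1}tx ltr_pM2r.
have y2 : k.+1%:R * a <= t0 + a.
  by apply: (@le_trans _ _ ((x + 1) * a)); rewrite ?ler_pM2r // mulrDl mul1r -tx.
have a3 : a <= pi / 3 by rewrite /a ler_pM2l // lef_pV2 // posrE //; lra.
exists n, (k.+1%:R * a); split.
- by rewrite distrC; apply: rd; rewrite /= /ball /= ltr_distlC; apply/andP; split;
    move: hn; rewrite -/m -/a => hn; lra.
- by rewrite gt_eqF // sin_gt0_pi //; apply/andP; split; lra.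
- rewrite -/m mulrCA /a [m * _]mulrC divfK ?gt_eqF //.
  elim: (k.+1) => [|j IH]; first by rewrite mul0r sin0.
  by rewrite -addn1 natrD mulrDl mul1r sinDpi IH oppr0.
Qed.
End CosDensity.

(** * Holes of the zero-free region *)

Lemma continuous_horner_num (K : numFieldType) (p : {poly K}) :
  continuous (horner p : K -> K).
Proof.
elim/poly_ind: p => [|p c IH].
  rewrite (_ : horner 0 = cst 0); first exact: cst_continuous.
  by apply/funext => w; rewrite horner0.
rewrite (_ : horner _ = (horner p : K -> K) * id + cst c); last first.
  by apply/funext => w; rewrite !hornerE.
move=> z; apply: (@continuousD K K K); last exact: cst_continuous.
by apply: (@continuousM K K); [exact: IH|exact: cvg_id].
Qed.
Lemma continuous_pencil (K : numFieldType) (P Q : {poly K}) :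
  continuous (fun zc : K * K => (P + zc.2 *: Q).[zc.1] : K).
Proof.
rewrite (_ : (fun _ => _) = (horner P \o fst : K * K -> K) + snd * (horner Q \o fst : K * K -> K)); last first.
  by apply/funext => zc; rewrite hornerD hornerZ.
have c1 p : continuous (horner p \o fst : K * K -> K).
  by move=> z; apply: continuous_comp; [exact: cvg_fst|exact: continuous_horner_num].
move=> z; apply: (@continuousD K K (K * K)%type); first exact: c1.
by apply: (@continuousM K (K * K)%type); [exact: cvg_snd|exact: c1].
Qed.

Section ZeroFreeRegion.
Variables (R : realType) (D : nat).
Hypothesis D2 : (2 <= D)%N.
Let Omega : set R[i]^o := ~` zero_locus R D.

Lemma zeros_tree (z : R[i]) t : valid D t -> ztree z t = 0 -> zeros R D z.
Proof.
by move=> /(tree_graph z)[G [v [mG _ zG _]]] zt; exists G; rewrite ?zG.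
Qed.

Lemma tree_at0 t : ztree (0 : R[i]) t = 1 /\ zdel (0 : R[i]) t = 1.
Proof.
elim: t => [|a [za da] b [zb db]].
  by rewrite ztree_Single zdel_Single addr0.
by rewrite ztree_Link zdel_Link za da zb db; split; ring.
Qed.

Lemma zero_locusC_ball (z : R[i]^o) : Omega z ->
  exists2 r : R[i], 0 < r & forall w : R[i], `|(z : R[i]) - w| < r -> ~ zeros R D w.
Proof.
move=> Oz; apply: contrapT => nr; apply: Oz => B /nbhs_ballP[r /= r0 rB].
apply: contrapT => ne; apply: nr; exists r => // w zw Zw.
by apply: ne; exists w; split=> //; apply: rB; rewrite -ball_normE.
Qed.

(* The zeros of [P + c *: Q] are, for a dense set of [c] in [0, 4], zeros of the
   independence polynomials of longer and longer paths or caterpillars. *)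
Definition pencil (P Q : {poly R[i]}) := [/\ P.[0] = 1, Q.[0] = 0 &
  forall n (th : R) z, sin th != 0 -> sin (n.+3%:R * th) = 0 ->
   (P + (4 * cos th ^+ 2)%:C%C *: Q).[z] = 0 -> zeros R D z].

(** Along the spine the values obey [path_transfer] with [b = ztree z t] and [e = z * zdel z t];
    that [z] is a root of the pencil is the relation between [b] and [e] required there. *)
Lemma pencil_caterpillar t : (3 <= D)%N -> valid D t -> (rdeg t < D)%N ->
  pencil (ztree 'X t) ('X * zdel 'X t).
Proof.
move=> D3 vt dt; have [z0 d0] := tree_at0 t.
have [zX dX] : (ztree 'X t).[0 : R[i]] = 1 /\ (zdel 'X t).[0 : R[i]] = 1.
  by have [-> ->] := horner_ztree (0 : R[i]) t.
split=> // [|n th z s0 sn Fz]; first by rewrite hornerM hornerX mul0r.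
apply: (zeros_tree (valid_caterpillar n D3 vt dt)).
move: Fz; rewrite hornerD hornerZ hornerM hornerX.
have [-> -> Fz] := horner_ztree z t.
have zn : ztree z (caterpillar t n) * (sin th)%:C%C = 0.
  rewrite (@path_transfer R R[i] (real_complex R) th (ztree z t) (z * zdel z t)
    (ztree z \o caterpillar t) (zdel z \o caterpillar t)) /= ?Fz //.
  - by rewrite sn rmorph0 mulr0.
  - by rewrite ztree_leaf.
  - by rewrite zdel_Link zdel_Single mul1r.
  - by move=> m; rewrite ztree_Link ztree_leaf zdel_Link zdel_Single; ring.
  - by move=> m; rewrite zdel_Link zdel_Link zdel_Single; ring.
by move/eqP: zn; rewrite mulf_eq0 => /orP[/eqP//|]; rewrite (inj_eq (@complexI _) _ 0) (negbTE s0).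
Qed.

Lemma pencil_path : pencil 1 'X.
Proof.
split=> [||n th z s0 sn]; [by rewrite hornerE|by rewrite hornerE|].
rewrite hornerD hornerZ hornerX hornerC => Fz.
apply: (zeros_tree (valid_path_tree n D2)).
have zn : ztree z (path_tree n) * (sin th)%:C%C = 0.
  rewrite (@path_transfer R R[i] (real_complex R) th 1 z
    (ztree z \o path_tree) (zdel z \o path_tree) Fz) //=.
  - by rewrite sn rmorph0 mulr0.
  - by move=> m; rewrite ztree_leaf; ring.
  - by move=> m; rewrite zdel_Link zdel_Single.
by move/eqP: zn; rewrite mulf_eq0 => /orP[/eqP//|]; rewrite (inj_eq (@complexI _) _ 0) (negbTE s0).
Qed.

Lemma gt0_complex (d : R[i]) : 0 < d -> exists2 e : R, 0 < e & d = e%:C%C.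
Proof.
by case: d => a b; rewrite ltcE /= => /andP[/eqP-> a0]; exists a.
Qed.

Lemma distC_real (a b : R) : `|a%:C%C - b%:C%C| = `|a - b|%:C%C.
Proof. by rewrite -rmorphB normc_def /= expr0n addr0 sqrtr_sqr. Qed.

(** A root at [c] would persist for a nearby parameter [4 cos^2(th)] and give a zero inside a ball
    around [z] that contains none. Persistence applies because the value at 0 is 1, so the pencil is
    not identically zero. *)
Lemma pencil_neq0 P Q (c : R) (z : R[i]^o) : pencil P Q -> Omega z -> 0 <= c <= 4 ->
  (P + c%:C%C *: Q).[z] != 0.
Proof.
move=> [P0 Q0 PQ] Oz c04; apply/eqP => Fz.
have [r r0 rz] := zero_locusC_ball Oz.
have [|d d0 dP] := root_persistence (w := 0) r0 Fz.
  by rewrite hornerD hornerZ P0 Q0 mulr0 addr0 oner_eq0.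
have [e e0 de] := gt0_complex d0.
have [n [th [cth s0 sn]]] := four_cos_sqr_dense c04 e0.
have [|w zw Fw] := dP (4 * cos th ^+ 2)%:C%C.
  by rewrite de distC_real ltcR.
exact: rz zw (PQ _ _ _ s0 sn Fw).
Qed.

Lemma continuous_real_complex : continuous (real_complex R : R -> R[i]^o).
Proof.
move=> c; apply/cvgrPdist_lt => e /gt0_complex[d d0 ->].
near=> x; rewrite distC_real ltcR.
near: x; exact: cvgr_dist_lt.
Unshelve. all: by end_near. Qed.

Lemma pencil_compact P Q (K : set R[i]^o) : pencil P Q -> compact K ->
  (forall z, K z -> Omega z \/ K^° z) -> (forall z, K z -> P.[z] != 0) ->
  forall (c : R) z, 0 <= c <= 4 -> K z -> (P + c%:C%C *: Q).[z] != 0.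
Proof.
move=> PQ cK KO P0.
pose F (c : R) (z : R[i]) := (P + c%:C%C *: Q).[z].
pose good := [set c : R | forall z, K z -> F c z != 0].
(* Only roots interior to [K] are recorded, which makes the set open. A root at any other point of
   [K] would lie in [Omega], against [pencil_neq0], so on [[0, 4]] this is the complement of
   [good]. *)
pose bad := [set c : R | exists2 z, K^° z & F c z = 0].
have ob : open bad.
  rewrite openE => c [z Kz Fz]; have /nbhs_ballP[r /= r0 rK] : nbhs (z : R[i]^o) K^° by exact: nbhs_interior.
  have [||d d0 dP] := @root_persistence _ P Q c%:C%C z 0 r r0 => //.
    by case: PQ => p0 q0 _; rewrite hornerD hornerZ p0 q0 mulr0 addr0 oner_eq0.
  have [e e0 de] := gt0_complex d0.
  apply/nbhs_ballP; exists e => //= c' cc'.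
  have [|w zw Fw] := dP c'%:C%C.
    rewrite de distC_real ltcR.
    by move: cc'; rewrite /ball /= distrC.
  exists w; last exact: Fw.
  by apply: rK; rewrite -ball_normE; exact: zw.
(* By joint continuity each point of [K] stays nonvanishing for nearby points and parameters;
   compactness of [K] gives one neighbourhood of [c] for all of them. *)
have og : open good.
  rewrite openE => c gc.
  have near_good : \forall c' \near (c%:C%C : R[i]^o), forall z, K z -> (P + c' *: Q).[z] != 0.
    have /compact_near_coveringP cvK := cK.
    apply: (cvK R[i]^o (nbhs (c%:C%C : R[i]^o)) (fun c z => (P + c *: Q).[z] != 0) (nbhs_filter _)) => z Kz.
    exact: cvgr_neq0 (@continuous_pencil R[i] P Q (z, c%:C%C)) (gc _ Kz).
  exact: (continuous_real_complex near_good).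
have F0 z : F 0 z = P.[z] by rewrite /F rmorph0 scale0r addr0.
have goodE : `[0, 4]%classic `&` good = `[0, 4]%classic.
  apply: (@segment_connected R 0 4).
  - by exists 0; split; [rewrite /= in_itv /=; lra|move=> z /P0; rewrite F0].
  - by exists good.
  - exists (~` bad); first exact: open_closedC.
    apply/seteqP; split=> c [c04 gc]; split=> //.
      by move=> [z /interior_subset Kz /eqP]; apply/negP/gc.
    move=> z Kz; apply/eqP => Fz; have [Oz|iz] := KO _ Kz.
      have /eqP := Fz; apply/negP/pencil_neq0 => //; by rewrite -in_itv.
    by apply: gc; exists z.
move=> c z c04 Kz; have : (`[0, 4]%classic `&` good) c by rewrite goodE /= in_itv.
by case=> _; apply.
Qed.

(** Write [z = - r s] with [r + s = 1]; then [r - s] times the polynomial is [r^(n+3) - s^(n+3)]. At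
    a zero [|r| = |s|], so [r = 1/2 + i b] and [z = - (1/4 + b^2)]. Such a [z] is a root of the
    pencil [1 + c X] with [c] in [[0, 4]]. *)
Lemma path_tree_root n (z : R[i]) : ztree z (path_tree n) = 0 ->
  exists2 c : R, 0 <= c <= 4 & 1 + c%:C%C * z = 0.
Proof.
move=> zn; have [r [s [rs zE]]] : exists r s : R[i], r + s = 1 /\ z = - (r * s).
  pose d := sqrtC (1 + 4 * z); exists ((1 + d) / 2), ((1 - d) / 2).
  split; first by field.
  have -> : (1 + d) / 2 * ((1 - d) / 2) = (1 - d ^+ 2) / 4 by field.
  by rewrite sqrtCK; field.
have AB m : (r - s) * ztree z (path_tree m) = r ^+ m.+3 - s ^+ m.+3 /\
    (r - s) * zdel z (path_tree m) = r ^+ m.+2 - s ^+ m.+2.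
  have sE : s = 1 - r by rewrite -rs; ring.
  elim: m => [|m [IHA IHB]].
    by rewrite ztree_Single zdel_Single zE sE; split; ring.
  rewrite ztree_leaf zdel_Link zdel_Single mul1r IHA; split=> //.
  rewrite mulrDr IHA mulrCA IHB zE sE (exprS r m.+3) (exprS (1 - r) m.+3).
  rewrite (exprS r m.+2) (exprS (1 - r) m.+2).
  by move: (r ^+ m.+2) ((1 - r) ^+ m.+2) => X Y; ring.
have /eqP : r ^+ n.+3 = s ^+ n.+3.
  by apply/eqP; rewrite -subr_eq0 -(AB n).1 zn mulr0.
move=> /eqP/(congr1 Num.norm); rewrite !normrX => /eqP.
rewrite eqrXn2 // => /eqP rsn.
have sE : s = 1 - r by rewrite -rs; ring.
move: rsn zE; rewrite sE; case: r {rs AB sE} => a b rsn zE.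
have a2 : a = 1 / 2.
  have : `|a +i* b|%C ^+ 2 = `|1 - (a +i* b)%C| ^+ 2 by rewrite rsn.
  rewrite -!add_Re2_Im2 => /complexI /=; rewrite sub0r sqrrN => /addIr.
  by rewrite (_ : (1 - a) ^+ 2 = 1 - 2 * a + a ^+ 2); [lra|ring].
exists (1 / 4 + b ^+ 2)^-1.
  have := sqr_ge0 b; set u := b ^+ 2 => u0.
  rewrite invr_ge0 addr_ge0 //=; last by lra.
  by rewrite -[X in _ <= X]invrK lef_pV2 ?posrE; lra.
have -> : z = - (1 / 4 + b ^+ 2)%:C%C.
  rewrite zE a2; congr (- _); apply/eqP; rewrite eq_complex /=.
  by apply/andP; split; apply/eqP; field.
have u0 : 1 / 4 + b ^+ 2 != 0 by have := sqr_ge0 b => b0; apply/eqP; lra.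
by rewrite mulrN -rmorphM /= mulVf // subrr.
Qed.

Lemma tree_path t : valid 2 t -> (rdeg t < 2)%N -> exists n, t = path_tree n.
Proof.
elim: t => [|a _ b IHb] /=; first by exists 0%N.
case: a => [|? ?] //= /andP[vb db] _.
by have [n ->] := IHb vb db; exists n.+1.
Qed.

Lemma tree_neq0_compact (K : set R[i]^o) : compact K ->
  (forall z, K z -> Omega z \/ K^° z) ->
  forall t z, valid D t -> K z -> ztree z t != 0.
Proof.
move=> cK KO t; have [n] := ubnP (tree_size t); elim: n t => // n IH t.
have path0 z m : K z -> ztree z (path_tree m) != 0.
  move=> Kz; apply/eqP => /path_tree_root[c c04 cz].
  have P1 w : K w -> (1 : {poly R[i]}).[w] != 0 by rewrite hornerC oner_eq0.
  have := pencil_compact pencil_path cK KO P1 c04 Kz.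
  by rewrite hornerD hornerZ hornerX hornerC cz eqxx.
case: t => [|a b] st z vt Kz; first exact: (path0 z 0%N).
have [t [/= /and3P[vt' _ dt]]] := @ztree_reroot R[i] D a b vt.
rewrite -/(tree_size (Link a b)) => st' ->.
case: (ltngtP 2 D) D2 => // [D3 _|DE _].
  have Pt w : K w -> (ztree 'X t).[w : R[i]] != 0.
    move=> Kw; have [-> _] := horner_ztree (w : R[i]) t; apply: IH => //.
    by rewrite -ltnS (leq_trans _ st) // st'.
  have c04 : 0 <= (1 : R) <= (4 : R) by apply/andP; split; lra.
  have := pencil_compact (pencil_caterpillar D3 vt' dt) cK KO Pt c04 Kz.
  rewrite rmorph1 scale1r hornerD hornerM hornerX.
  by have [-> ->] := horner_ztree (z : R[i]) t; rewrite -ztree_leaf.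
move: vt' dt; rewrite -DE => vt' dt; have [m ->] := tree_path vt' dt.
exact: (path0 z m.+1).
Qed.

(* The complement of [Omega] has no bounded relatively clopen part. *)
Lemma zero_locusC_fill (K : set R[i]^o) : compact K ->
  (forall z, K z -> Omega z \/ K^° z) -> K `<=` Omega.
Proof.
move=> cK KO z Kz; have [//|iz] := KO _ Kz; move=> clz.
have [w [[G mG wG] Kw]] := clz _ iz.
have [t vt wt] := indep_poly_tree mG wG.
by have := tree_neq0_compact cK KO vt Kw; rewrite wt eqxx.
Qed.

End ZeroFreeRegion.

(** * Closed lattice walks *)

Notation vtx := (int * int)%type.

Definition ldist (a b : vtx) : nat := (`|a.1 - b.1| + `|a.2 - b.2|)%N.

Fixpoint walk_parity (c : rel vtx) x (l : seq vtx) : bool :=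
  if l is y :: l' then c x y (+) walk_parity c y l' else false.

Lemma walk_parity_cat c x l1 l2 : walk_parity c x (l1 ++ l2) =
  walk_parity c x l1 (+) walk_parity c (last x l1) l2.
Proof. by elim: l1 x => //= y l1 IH x; rewrite IH addbA. Qed.

Lemma walk_parity_add c1 c2 x l :
  walk_parity (fun a b => c1 a b (+) c2 a b) x l =
  walk_parity c1 x l (+) walk_parity c2 x l.
Proof.
elim: l x => //= y l IH x; rewrite IH.
by rewrite -!addbA; congr addb; rewrite addbCA.
Qed.

(** The sum telescopes. On a closed walk it vanishes, so relations of this form may be added to a
    crossing count at no cost. *)
Lemma walk_parity_boundary (W : pred vtx) x l :
  walk_parity (fun a b => W a (+) W b) x l = W x (+) W (last x l).
Proof.
elim: l x => [|y l IH] x /=; first by rewrite addbb.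
by rewrite IH addbA -[_ (+) W y]addbA addbb addbF.
Qed.

Lemma eq_walk_parity (e c1 c2 : rel vtx) x l :
  (forall a b, e a b -> c1 a b = c2 a b) -> path e x l ->
  walk_parity c1 x l = walk_parity c2 x l.
Proof.
move=> h; elim: l x => //= y l IH x /andP[exy pl]; by rewrite h // IH.
Qed.

Lemma walk_parity_odd (e c : rel vtx) x l : path e x l -> walk_parity c x l ->
  exists a b, [/\ a \in x :: l, b \in x :: l, e a b & c a b].
Proof.
elim: l x => //= y l IH x /andP[exy pl]; case cxy: (c x y).
  by move=> _; exists x, y; rewrite !inE !eqxx ?orbT.
move=> /(IH _ pl)[a [b [al bl eab cab]]]; exists a, b.
by rewrite !(in_cons x) al bl !orbT.
Qed.

Lemma walk_parity_avoid (c : rel vtx) p x l :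
  (forall a b, a \in x :: l -> b \in x :: l -> c a b -> a = p \/ b = p) ->
  p \notin x :: l -> walk_parity c x l = false.
Proof.
elim: l x => //= y l IH x h pl; rewrite IH.
- rewrite addbF; apply/negP => /h; rewrite !inE !eqxx orbT => -[]// E;
  by move: pl; rewrite -E !inE eqxx ?orbT.
- by move=> a b al bl; apply: h; rewrite (in_cons x) ?al ?bl orbT.
- by apply: contra pl; rewrite (in_cons x) => ->; rewrite orbT.
Qed.

(* The upward ray from the cell with lower left corner [(i, j)] meets the
   horizontal edges from [(i, k)] to [(i + 1, k)] with [j < k]. *)
Definition crosses (c : vtx) (a b : vtx) : bool :=
  [&& a.2 == b.2, c.2 < a.2 & (a.1 == c.1) && (b.1 == c.1 + 1) ||
                              (b.1 == c.1) && (a.1 == c.1 + 1)].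

Definition crosses_down (c : vtx) (a b : vtx) : bool :=
  [&& a.2 == b.2, a.2 <= c.2 & (a.1 == c.1) && (b.1 == c.1 + 1) ||
                              (b.1 == c.1) && (a.1 == c.1 + 1)].

(** For a closed lattice walk this is the winding number modulo 2 around the cell. *)
Definition enclosed x l (c : vtx) := walk_parity (crosses c) x l.

Definition corner (c a : vtx) : bool :=
  ((a.1 == c.1) || (a.1 == c.1 + 1)) && ((a.2 == c.2) || (a.2 == c.2 + 1)).

Lemma neq_addb (a b : bool) : (a != b) = a (+) b.
Proof. by case: a; case: b. Qed.

Lemma ldist_le1 a b : (ldist a b <= 1)%N ->
  [\/ b = a, b = (a.1 + 1, a.2) \/ b = (a.1 - 1, a.2),
      b = (a.1, a.2 + 1) | b = (a.1, a.2 - 1)].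
Proof.
rewrite /ldist; case: a b => [a1 a2] [b1 b2] /= h.
have [E|[E|[E|[E|E]]]] : (b1 = a1 /\ b2 = a2) \/ (b1 = a1 + 1 /\ b2 = a2) \/
    (b1 = a1 - 1 /\ b2 = a2) \/ (b1 = a1 /\ b2 = a2 + 1) \/ (b1 = a1 /\ b2 = a2 - 1).
  by lia.
all: case: E => -> ->.
- by constructor 1.
- by constructor 2; left.
- by constructor 2; right.
- by constructor 3.
- by constructor 4.
Qed.

Lemma ldist_sym a b : ldist a b = ldist b a.
Proof. by rewrite /ldist; lia. Qed.

(** Of two opposite neighbours of [p] one is farther from [x] than [p] is. Hence one of [u], [w] is
    a horizontal neighbour and the other a vertical one, both a step closer to [x]; [dx] and [dy]
    are the signs of [p - x]. *)
Lemma farthest_corner (x u p w : vtx) : (ldist p u <= 1)%N -> (ldist p w <= 1)%N ->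
  u != p -> w != p -> u != w ->
  (ldist u x <= ldist p x)%N -> (ldist w x <= ldist p x)%N ->
  exists dx dy, [/\ (dx = 1 /\ x.1 < p.1) \/ (dx = -1 /\ p.1 < x.1),
    (dy = 1 /\ x.2 < p.2) \/ (dy = -1 /\ p.2 < x.2) &
    (u = (p.1 - dx, p.2) /\ w = (p.1, p.2 - dy)) \/
    (u = (p.1, p.2 - dy) /\ w = (p.1 - dx, p.2))].
Proof.
case: x p => [x1 x2] [p1 p2].
move=> /ldist_le1[->|[->|->]|->|->]; rewrite ?eqxx //;
move=> /ldist_le1[->|[->|->]|->|->]; rewrite ?eqxx // /ldist /= => _ _ _ h1 h2.
- by exfalso; lia.
- exists (-1), (-1); rewrite ?opprK; split; [right; split=> //; lia|right; split=> //; lia|by left].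
- exists (-1), 1; rewrite ?opprK; split; [right; split=> //; lia|left; split=> //; lia|by left].
- by exfalso; lia.
- exists 1, (-1); rewrite ?opprK; split; [left; split=> //; lia|right; split=> //; lia|by left].
- exists 1, 1; rewrite ?opprK; split; [left; split=> //; lia|left; split=> //; lia|by left].
- exists (-1), (-1); rewrite ?opprK; split; [right; split=> //; lia|right; split=> //; lia|by right].
- exists 1, (-1); rewrite ?opprK; split; [left; split=> //; lia|right; split=> //; lia|by right].
- by exfalso; lia.
- exists (-1), 1; rewrite ?opprK; split; [right; split=> //; lia|left; split=> //; lia|by right].
- exists 1, 1; rewrite ?opprK; split; [left; split=> //; lia|left; split=> //; lia|by right].
- by exfalso; lia.
Qed.

Section Lattice.
Variable e : rel vtx.
Hypothesis e_dist : forall a b, e a b -> (ldist a b <= 1)%N.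

(** The upward and downward rays together meet all edges between the columns [c.1] and [c.1 + 1],
    which a closed walk uses an even number of times. *)
Lemma enclosed_down x l c : path e x l -> last x l = x ->
  enclosed x l c = walk_parity (crosses_down c) x l.
Proof.
move=> pl lx; suff: enclosed x l c (+) walk_parity (crosses_down c) x l = false.
  by case: enclosed; case: walk_parity.
have := walk_parity_boundary (fun a => a.1 <= c.1) x l; rewrite lx addbb => <-.
rewrite /enclosed -walk_parity_add; apply: (eq_walk_parity _ pl) => a b /e_dist.
rewrite /ldist /crosses /crosses_down; case: a b c => [a1 a2] [b1 b2] [i j] /=.
lia.
Qed.

(** The two rays differ in the common edge of the cells only, so the walk traverses that edge. *)
Lemma enclosed_vert x l (i j : int) : enclosed x l (i, j) != enclosed x l (i, j + 1) ->
  path e x l ->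
  exists a b, [/\ e a b, corner (i, j) a, corner (i, j) b,
    corner (i, j + 1) a & corner (i, j + 1) b] /\ a != b.
Proof.
rewrite neq_addb /enclosed => odd pl; move: odd; rewrite -walk_parity_add.
move=> /(walk_parity_odd pl)[a [b [_ _ eab]]].
rewrite /crosses /corner; case: a b eab => [a1 a2] [b1 b2] eab /= h.
exists (a1, a2), (b1, b2); split; last by rewrite xpair_eqE; lia.
by split=> //=; lia.
Qed.

(** Adding the boundary of the half-column of vertices [(i + 1, k)] with [j < k] cancels the
    horizontal edges met by either ray and leaves the vertical edge shared by the two cells. *)
Lemma enclosed_horiz x l (i j : int) : enclosed x l (i, j) != enclosed x l (i + 1, j) ->
  path e x l -> last x l = x ->
  exists a b, [/\ e a b, corner (i, j) a, corner (i, j) b,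
    corner (i + 1, j) a & corner (i + 1, j) b] /\ a != b.
Proof.
rewrite neq_addb /enclosed => odd pl lx; move: odd; rewrite -walk_parity_add.
have := walk_parity_boundary (fun a => (a.1 == i + 1) && (j < a.2)) x l.
rewrite lx addbb; set g := (fun a b => _ (+) _) => b0.
set f := (fun a b => _ (+) _) => odd.
have : walk_parity (fun a b => f a b (+) g a b) x l.
  by rewrite walk_parity_add b0 addbF.
rewrite /f /g => /(walk_parity_odd pl)[a [b [_ _ eab]]].
rewrite /crosses /corner; move: (ldist_le1 (e_dist eab)) => sh h; exists a, b; move: sh h eab.
case: a => [a1 a2]; case=> [->|[->|->]|->|->] /= h eab.
- by exfalso; lia.
- by exfalso; lia.
- by exfalso; lia.
- by split; [split=> //; lia|rewrite xpair_eqE; lia].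
- by split; [split=> //; lia|rewrite xpair_eqE; lia].
Qed.

(** An enclosed cell has edges of the walk both above and below it. *)
Lemma enclosed_bound x l (c : vtx) (M : nat) : path e x l -> last x l = x ->
  (forall a, a \in x :: l -> (`|a.1| <= M)%N && (`|a.2| <= M)%N) -> enclosed x l c ->
  (`|c.1| <= M.+1)%N /\ (`|c.2| <= M)%N.
Proof.
move=> pl lx hM hc; have := hc; rewrite (enclosed_down _ pl lx).
move=> /(walk_parity_odd pl)[a [b [al bl _ +]]].
move: hc => /(walk_parity_odd pl)[a' [b' [al' _ _ +]]].
move: (hM _ al) (hM _ bl) (hM _ al').
rewrite /crosses /crosses_down /ldist; case: a b a' c {al bl al'} => [a1 a2] [b1 b2] [a1' a2'] [i j] /=.
lia.
Qed.

(** * Contraction of closed walks by elementary moves *)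

Variable flat : vtx -> vtx -> vtx -> vtx -> Prop.
Variable cell_ok : vtx -> Prop.

(** [flat u v w v'] stands for the possibility of sliding [u, v, w] to [u, v', w] within the domain,
    and [cell_ok] for cells contained in it. Both stay abstract, so that the contraction is purely
    combinatorial. *)
Inductive reduce1 : seq vtx -> seq vtx -> Prop :=
| ReduceStutter l1 u l2 : reduce1 (l1 ++ u :: u :: l2) (l1 ++ u :: l2)
| ReduceMove l1 u v w v' l2 : flat u v w v' ->
    reduce1 (l1 ++ u :: v :: w :: l2) (l1 ++ u :: v' :: w :: l2).

Inductive reduces : seq vtx -> seq vtx -> Prop :=
| ReducesRefl l : reduces l l
| ReducesStep l l' l'' : reduce1 l l' -> reduces l' l'' -> reduces l l''.

Lemma reduces_trans l l' l'' : reduces l l' -> reduces l' l'' -> reduces l l''.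
Proof. by elim=> // a b c ab _ IH /IH; exact: ReducesStep. Qed.

Lemma reduces_context l1 l2 l l' :
  reduces l l' -> reduces (l1 ++ l ++ l2) (l1 ++ l' ++ l2).
Proof.
elim=> [a|a b c ab _]; first exact: ReducesRefl.
apply: ReducesStep; case: ab => [k1 u k2|k1 u v w v' k2 uv].
  by rewrite -!catA !catA -(catA _ _ l2) -[(_ ++ u :: k2) ++ _]catA; exact: ReduceStutter.
by rewrite -!catA !catA -(catA _ _ l2) -[(_ ++ [:: u, v', w & k2]) ++ _]catA; exact: ReduceMove.
Qed.

Hypothesis flat_back : forall u v, e u v -> flat u v u u.
Hypothesis flat_cell : forall c u v w v', cell_ok c ->
  [&& corner c u, corner c v, corner c w & corner c v'] -> flat u v w v'.
Hypothesis e_cell : forall c u v, cell_ok c -> corner c u -> corner c v ->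
  (ldist u v <= 1)%N -> e u v.
Hypothesis enclosed_ok : forall x l c, path e x l -> last x l = x ->
  enclosed x l c -> cell_ok c.

(** The cell at [p] on the side of [x] is enclosed: a ray leaving it away from [x] can meet the walk
    only in an edge at [p], and just one of the two edges at [p] is horizontal. Hence [p] can be
    pushed to the opposite corner of the cell. *)
Lemma flip_farthest x u p w l1 l2 :
  path e x (l1 ++ p :: w :: l2) -> last x (l1 ++ p :: w :: l2) = x ->
  p \notin x :: l1 -> p \notin w :: l2 -> u = last x l1 -> u != w ->
  (forall q, q \in x :: l1 ++ p :: w :: l2 -> (ldist q x <= ldist p x)%N) ->
  exists v, [/\ flat u p w v, e u v, e v w & (ldist v x < ldist p x)%N].
Proof.
move=> pl lx pl1 pl2 uE uw far.
have [eup epw] : e u p /\ e p w.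
  by move: pl; rewrite cat_path /= -uE => /and4P[].
have uin : u \in x :: l1 by rewrite uE mem_last.
have up : u != p by apply: contraNneq pl1 => <-.
have wp : w != p by apply: contraNneq pl2 => <-; rewrite mem_head.
have uf : (ldist u x <= ldist p x)%N.
  by apply: far; move: uin; rewrite !inE mem_cat => /orP[->//|->]; rewrite orbT.
have wf : (ldist w x <= ldist p x)%N by apply: far; rewrite !inE mem_cat !inE eqxx !orbT.
have pu : (ldist p u <= 1)%N by rewrite ldist_sym e_dist.
have [dx [dy [hx hy huw]]] := farthest_corner pu (e_dist epw) up wp uw uf wf.
pose v := (p.1 - dx, p.2 - dy).
pose c := (if x.1 < p.1 then p.1 - 1 else p.1, if x.2 < p.2 then p.2 - 1 else p.2).
have geo : [/\ [&& corner c u, corner c p, corner c w & corner c v],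
   (ldist u v <= 1)%N, (ldist v w <= 1)%N & (ldist v x < ldist p x)%N].
  rewrite /c /v; clear -hx hy huw.
  case: hx => -[-> hx] in huw *; case: hy => -[-> hy] in huw *;
  rewrite ?hx ?hy ?(lt_gtF hx) ?(lt_gtF hy);
  case: huw => -[-> ->]; move: hx hy;
  case: p x => [p1 p2] [x1 x2]; rewrite /corner /ldist /= => hx hy; split; lia.
have [cor uv vw vp] := geo; case/and4P: (cor) => cu cp cw cv.
suff ok : cell_ok c.
  by exists v; split=> //; [exact: (flat_cell ok)|exact: (e_cell ok)|exact: (e_cell ok)].
apply: (enclosed_ok pl lx).
(* As [p] is visited once, only the steps into and out of [p] contribute. *)
have parity (f : rel vtx) :
    (forall a b, (ldist a x <= ldist p x)%N -> (ldist b x <= ldist p x)%N ->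
       f a b -> (a == p) || (b == p)) -> f u p (+) f p w ->
    walk_parity f x (l1 ++ p :: w :: l2).
  move=> fp fodd; rewrite walk_parity_cat /= -uE.
  have sub a : (a \in x :: l1) || (a \in w :: l2) -> (ldist a x <= ldist p x)%N.
    by move=> h; apply: far; rewrite -cat_cons mem_cat; case/orP: h => h; rewrite ?h // (in_cons p) h !orbT.
  rewrite (@walk_parity_avoid f p x l1) ?(@walk_parity_avoid f p w l2) ?addbF //.
    move=> a b al bl fab.
    have da : (ldist a x <= ldist p x)%N by apply: sub; rewrite al ?orbT.
    have db : (ldist b x <= ldist p x)%N by apply: sub; rewrite bl ?orbT.
    by case/orP: (fp _ _ da db fab) => /eqP; [left|right].
  move=> a b al bl fab.
  have da : (ldist a x <= ldist p x)%N by apply: sub; rewrite al ?orbT.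
  have db : (ldist b x <= ldist p x)%N by apply: sub; rewrite bl ?orbT.
  by case/orP: (fp _ _ da db fab) => /eqP; [left|right].
rewrite /c; clear -hx hy huw parity pl lx e_dist.
(* The ray must point away from [x]: upward if [p] is above [x], downward otherwise. *)
case: hy => -[-> hy] in huw *; rewrite ?hy ?(lt_gtF hy);
  last rewrite (enclosed_down _ pl lx);
  (case: hx => -[-> hx] in huw *; rewrite ?hx ?(lt_gtF hx));
  (apply: parity => [[a1 a2] [b1 b2]|]; [
    move: hx hy; clear; case: p x => [p1 p2] [x1 x2]; rewrite !xpair_eqE;
    rewrite /crosses /crosses_down /ldist /= => hx hy; lia
  | case: huw => -[-> ->]; rewrite /crosses /crosses_down /=; lia]).
Qed.

Lemma not_uniq_split (T : eqType) (l : seq T) : ~~ uniq l ->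
  exists l1 u l2 l3, l = l1 ++ u :: l2 ++ u :: l3.
Proof.
elim: l => //= a l IH; rewrite negb_and negbK => /orP[al|/IH[l1 [u [l2 [l3 ->]]]]].
  by case/splitPr: al => l2 l3; exists [::], a, l2, l3.
by exists (a :: l1), u, l2, l3.
Qed.

Lemma seq_argmax (T : eqType) (f : T -> nat) a (l : seq T) :
  exists2 p, p \in a :: l & forall q, q \in a :: l -> (f q <= f p)%N.
Proof.
elim: l a => [|b l IH] a; first by exists a; rewrite ?mem_head // => q; rewrite inE => /eqP->.
have [p pl hp] := IH b; have [fap|fpa] := leqP (f a) (f p).
  by exists p => [|q]; rewrite inE ?pl ?orbT // => /predU1P[->//|/hp].
exists a => [|q]; rewrite ?mem_head // inE => /predU1P[->//|/hp fq].
exact: leq_trans fq (ltnW fpa).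
Qed.

(** The outer induction is on the length, which drops when a subloop is removed; the inner one is on
    the sum of the distances to [x], which a flip lowers at constant length. *)
Lemma closed_walk_reduces x l : path e x l -> last x l = x ->
  reduces (x :: l) [:: x].
Proof.
have [n] := ubnP (size l); elim: n x l => // n IHn x l.
have [m] := ubnP (sumn [seq ldist v x | v <- l]); elim: m l => // m IHm l sm sl pl lx.
have [ul|] := boolP (uniq l); last first.
  move=> /not_uniq_split[l1 [u [l2 [l3 lE]]]]; rewrite {}lE in sm sl pl lx *.
  move: pl; rewrite cat_path /= cat_path /= => /and5P[pl1 e1 pl2 e2 pl3].
  have loop : reduces (u :: rcons l2 u) [:: u].
    apply: IHn; rewrite ?last_rcons // ?rcons_path ?pl2 //.
    by move: sl; rewrite size_rcons !size_cat /= size_cat /=; lia.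
  apply: (@reduces_trans _ (x :: l1 ++ u :: l3)).
    have := reduces_context (x :: l1) l3 loop.
    by rewrite /= cat_rcons.
  apply: IHn.
  - by move: sl; rewrite !size_cat /= size_cat /=; lia.
  - by rewrite cat_path /= pl1 e1 pl3.
  - by move: lx; rewrite !last_cat /= last_cat.
case: l => [|v [|w [|z l]]] in ul pl lx sm sl *.
- exact: ReducesRefl.
- rewrite /= in lx; rewrite lx; apply: ReducesStep (ReducesRefl _).
  exact: (@ReduceStutter [::] x [::]).
- rewrite /= in lx; rewrite lx; move: pl => /= /and3P[xv _ _].
  apply: ReducesStep (@ReduceMove [::] x v x x [::] (flat_back xv)) _.
  apply: ReducesStep (@ReduceStutter [::] x [:: x]) _.
  exact: ReducesStep (@ReduceStutter [::] x [::]) (ReducesRefl _).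
set l0 := [:: v, w, z & l] in ul pl lx sm sl *.
have [p pl0 pmax] : exists2 p, p \in l0 & forall q, q \in l0 -> (ldist q x <= ldist p x)%N.
  exact: seq_argmax.
have px : p != x.
  apply/eqP => px; have dx q : q \in l0 -> q = x.
    move=> /pmax; rewrite px /ldist; case: (q) (x) => [q1 q2] [x1 x2] /= h.
    by apply/eqP; rewrite xpair_eqE; lia.
  have vx : v = x by apply: dx; rewrite mem_head.
  have wx : w = x by apply: dx; rewrite in_cons mem_head orbT.
  by move: ul; rewrite /l0 vx wx cons_uniq mem_head.
have size0 : (2 < size l0)%N by [].
case/splitPr: pl0 => l1 [|w' l2] in ul pl lx sm sl pmax size0 *.
  by move: lx px; rewrite last_cat /= => ->; rewrite eqxx.
move: ul; rewrite cat_uniq /= => /and4P[ul1 /norP[pl1 /norP[wl1 _]] pl2 /andP[wl2 ul2]].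
(* Equality would repeat a vertex of the walk, or, for [l1] empty, close the walk after two steps, a
   length already treated. *)
have uw : last x l1 != w'.
  apply/eqP => uw; clear pl sm sl pmax; case: l1 => [|y l1] in ul1 pl1 wl1 uw lx size0 *.
    rewrite /= in uw; rewrite -uw in wl2; move: lx; rewrite /= -uw => lx.
    by case: l2 lx wl2 size0 {pl2 ul2} => //= y l2 <-; rewrite mem_last.
  by move: wl1; rewrite -uw /= mem_last.
have [v' [fl euv evw dv]] : exists v, [/\ flat (last x l1) p w' v, e (last x l1) v,
    e v w' & (ldist v x < ldist p x)%N].
  apply: (@flip_farthest x _ p w' l1 l2) => //.
    by rewrite inE negb_or px.
  move=> q; rewrite inE => /predU1P[->|/pmax//].
  by rewrite /ldist !subrr.
apply: (@ReducesStep _ (x :: l1 ++ v' :: w' :: l2)).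
  rewrite -!cat_cons lastI -!cats1 -!catA /=; exact: ReduceMove.
apply: IHm.
- move: sm dv; rewrite !map_cat !sumn_cat /=; clear.
  by move: (sumn _) (sumn _) (ldist v' x) (ldist p x) (ldist w' x) => *; lia.
- by move: sl; rewrite !size_cat.
- by move: pl; rewrite !cat_path /= => /and4P[-> _ _ ->]; rewrite euv evw.
- by move: lx; rewrite !last_cat.
Qed.

End Lattice.

(** * Straight-line homotopies *)

Section Clip.
Variable R : realType.
Implicit Types t : R.

(** The retraction of the line onto [[0, 1]], in terms of absolute values so that continuity is
    immediate. *)
Definition clip t : R := (1 + `|t| - `|t - 1|) / 2.

Lemma clip_id t : 0 <= t <= 1 -> clip t = t.
Proof.
by move=> /andP[t0 t1]; rewrite /clip ger0_norm // ler0_norm; [field|lra].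
Qed.

Lemma clip0 t : t <= 0 -> clip t = 0.
Proof. by move=> t0; rewrite /clip !ler0_norm; [ring|lra|lra]. Qed.

Lemma clip1 t : 1 <= t -> clip t = 1.
Proof. by move=> t1; rewrite /clip !ger0_norm; [field|lra|lra]. Qed.

Lemma clip_itv t : 0 <= clip t <= 1.
Proof.
have [t0|t0] := leP t 0; first by rewrite clip0 // lexx ler01.
have [t1|t1] := leP 1 t; first by rewrite clip1 // ler01 lexx.
by rewrite clip_id !ltW.
Qed.

Lemma continuous_clip : continuous clip.
Proof.
move=> t; apply: cvgM; last exact: cvg_cst.
apply: cvgB.
  apply: cvgD; [exact: cvg_cst|exact: norm_continuous].
apply: cvg_norm; apply: cvgB; [exact: cvg_id|exact: cvg_cst].
Qed.

End Clip.

(** Composing with [clip] trades continuity on the unit interval or square for continuity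
    everywhere. *)
Lemma continuous_within_comp (S T U : topologicalType) (A : set T) (g : S -> T)
  (f : T -> U) : {within A, continuous f} -> continuous g ->
  (forall x, A (g x)) -> continuous (f \o g).
Proof.
move=> /subspace_continuousP fA cg gA x W /(fA _ (gA x)) fW.
have near_x : \forall y \near x, A (g y) -> W (f (g y)) := cg x _ fW.
change (\forall y \near x, W (f (g y))); near=> y; have Wy : A (g y) -> W (f (g y)) by near: y.
exact: Wy (gA y).
Unshelve. all: by end_near. Qed.

Lemma continuous_pair (S T U : topologicalType) (f : S -> T) (g : S -> U) :
  continuous f -> continuous g -> continuous (fun z => (f z, g z)).
Proof. by move=> cf cg z; exact: (cvg_pair (cf z) (cg z)). Qed.

Lemma continuous_compose (S T U : topologicalType) (f : S -> T) (g : T -> U) :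
  continuous f -> continuous g -> continuous (fun z => g (f z)).
Proof. by move=> cf cg z; apply: (@continuous_comp _ _ _ f g z (cf z)); exact: cg. Qed.

Section Homotopy.
Variables (R : realType).
Let T : normedModType R := (R * R)%type.
Variable Omega : set T.

Lemma null_homotopic_cst x : Omega x -> null_homotopic Omega x (fun _ : R => x).
Proof.
move=> Ox; exists (fun _ => x); split=> //.
by apply: continuous_subspaceT => z; exact: cst_continuous.
Qed.

Definition clip_homotopy (H : R * R -> T) (z : R * R) := H (clip z.1, clip z.2).

Lemma continuous_clip_homotopy (H : R * R -> T) :
  {within `[0, 1] `*` `[0, 1], continuous H} -> continuous (clip_homotopy H).
Proof.
move=> cH; apply: (continuous_within_comp cH (g := fun z => (clip z.1, clip z.2))).
  by apply: continuous_pair; apply: continuous_compose (@continuous_clip R) => z;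
    [exact: cvg_fst|exact: cvg_snd].
by move=> z; split; rewrite /= in_itv /= clip_itv.
Qed.

(* The two homotopies are glued along [s = 1/2] by adding them and subtracting
   the common path [g]. *)
Lemma null_homotopic_straight x (f g : R -> T) : continuous f -> continuous g ->
  f 0 = x -> f 1 = x ->
  (forall s t, 0 <= s <= 1 -> 0 <= t <= 1 -> Omega ((1 - s) *: f t + s *: g t)) ->
  null_homotopic Omega x g -> null_homotopic Omega x f.
Proof.
move=> cf cg f0 f1 fg [H [cH HO H0 H1 Hx]].
have c01 (b : R) : 0 <= b <= 1 -> b \in `[0, 1] by rewrite in_itv.
have z01 : (0 : R) \in `[0, 1] by apply: c01; rewrite lexx ler01.
have o01 : (1 : R) \in `[0, 1] by apply: c01; rewrite lexx ler01.
have g0 : g 0 = x by rewrite -H0 // (Hx 0 z01).1.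
have g1 : g 1 = x by rewrite -H0 // (Hx 0 z01).2.
pose a (z : R * R) : R := clip (2 * z.1).
have c2 : continuous (fun z : R * R => 2 * z.1).
  by move=> z; apply: cvgM; [exact: cvg_cst|exact: cvg_fst].
have ca : continuous a by exact: continuous_compose c2 (@continuous_clip R).
have cH' := continuous_clip_homotopy cH.
have csnd (k : R -> T) : continuous k -> continuous (fun z : R * R => k z.2).
  by move=> ck; apply: continuous_compose ck => z; exact: cvg_snd.
pose F (z : R * R) : T := (1 - a z) *: f z.2 + a z *: g z.2 +
  (clip_homotopy H (2 * z.1 - 1, z.2) - clip_homotopy H (0, z.2)).
have cF : continuous F.
  move=> z; apply: cvgD; first apply: cvgD.
  - by apply: cvgZ; [apply: cvgB; [exact: cvg_cst|exact: ca]|exact: csnd].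
  - by apply: cvgZ; [exact: ca|exact: csnd].
  - apply: cvgB.
      apply: continuous_compose cH' _; apply: continuous_pair => [w|w]; last exact: cvg_snd.
      by apply: cvgB; [exact: c2|exact: cvg_cst].
    by apply: continuous_compose cH' _; apply: continuous_pair => [w|w];
      [exact: cvg_cst|exact: cvg_snd].
exists F; split.
- exact: continuous_subspaceT.
- move=> s t; rewrite !in_itv /= => s01 t01; have t1 := c01 _ t01.
  rewrite /F /a /clip_homotopy /= (clip_id t01) (clip0 (lexx 0)) (H0 _ t1).
  have [s2|s2] := leP (2 * s) 1.
    rewrite (@clip0 _ (2 * s - 1)) ?subr_le0 // H0 // subrr addr0.
    by apply: fg => //; rewrite clip_itv.
  rewrite (@clip1 _ (2 * s)) ?(ltW s2) // subrr scale0r add0r scale1r addrC subrK.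
  by apply: HO => //; apply: c01; rewrite clip_itv.
- move=> t t01; have t1 := t01; rewrite in_itv /= in t1.
  rewrite /F /a /clip_homotopy /= mulr0 (clip_id t1) (clip0 (lexx 0)) sub0r.
  by rewrite (@clip0 _ (-1)) ?lerN10 // subrr subr0 scale1r scale0r !addr0.
- move=> t t01; have t1 := t01; rewrite in_itv /= in t1.
  rewrite /F /a /clip_homotopy /= mulr1 (clip_id t1) (clip0 (lexx 0)).
  have -> : 2 - 1 = 1 :> R by ring.
  rewrite !(@clip1 _ 1) ?(@clip1 _ 2) ?ler1n // subrr scale0r add0r scale1r H1 // H0 //.
  by rewrite addrC subrK.
- move=> s s01; rewrite /F /a /clip_homotopy /=.
  have cs (b : R) : clip b \in `[0, 1] by apply: c01; rewrite clip_itv.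
  rewrite (clip0 (lexx 0)) (@clip1 _ 1) // f0 f1 g0 g1.
  rewrite (Hx _ (cs _)).1 (Hx _ (cs _)).2 (Hx _ z01).1 (Hx _ z01).2.
  by rewrite !subrr !addr0 -scalerDl subrK scale1r.
Qed.

End Homotopy.

(** * Piecewise linear loops *)

Section PiecewiseLinear.
Variables (R : realType).
Let T : normedModType R := (R * R)%type.
Variable Omega : set T.

(** The polygonal path that is at [p i] at time [i / n]: the increment from [p i] to [p i.+1] is
    switched on while [n t] runs from [i] to [i.+1]. *)
Definition pl n (p : nat -> T) (t : R) : T :=
  p 0%N + \sum_(0 <= i < n) clip (n%:R * t - i%:R) *: (p i.+1 - p i).

Lemma eq_pl n p q : (forall i, (i <= n)%N -> p i = q i) -> pl n p = pl n q.
Proof.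
move=> pq; apply/funext => t; rewrite /pl pq //; congr (_ + _).
by apply: eq_big_nat => i /andP[_ ltin]; rewrite !pq // ltnW.
Qed.

Lemma continuous_pl n p : continuous (pl n p).
Proof.
pose S m (t : R) : T := \sum_(0 <= i < m) clip (n%:R * t - i%:R) *: (p i.+1 - p i).
have cS m : continuous (S m).
  elim: m => [|m IH].
    rewrite /S (_ : (fun _ => _) = fun _ => 0); first by move=> z; exact: cvg_cst.
    by apply/funext => z; rewrite big_nil.
  rewrite (_ : S _ = fun t => S m t + clip (n%:R * t - m%:R) *: (p m.+1 - p m)); last first.
    by apply/funext => t; rewrite /S big_nat_recr.
  move=> t; apply: cvgD; first exact: IH.
  apply: cvgZr_tmp; move: t.
  apply: continuous_compose (@continuous_clip R) => z.
  by apply: cvgB; [apply: cvgM; [exact: cvg_cst|exact: cvg_id]|exact: cvg_cst].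
by move=> t; apply: cvgD; [exact: cvg_cst|exact: cS].
Qed.

Lemma pl_at n p t k : (k < n)%N -> k%:R <= n%:R * t <= k.+1%:R ->
  pl n p t = (1 - (n%:R * t - k%:R)) *: p k + (n%:R * t - k%:R) *: p k.+1.
Proof.
move=> ltkn /andP[kt tk]; set s := n%:R * t - k%:R.
have s01 : 0 <= s <= 1.
  by rewrite subr_ge0 kt /= lerBlDr nat1r.
rewrite /pl (big_cat_nat (n := k)) ?(ltnW ltkn) //=.
rewrite (big_ltn ltkn) -/s (clip_id s01).
have -> : \sum_(k.+1 <= i < n) clip (n%:R * t - i%:R) *: (p i.+1 - p i) = 0.
  rewrite big_nat big1 // => i /andP[ki _].
  by rewrite clip0 ?scale0r // subr_le0 (le_trans tk) // ler_nat.
rewrite addr0.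
rewrite [X in _ + (X + _)](_ : _ = \sum_(0 <= i < k) (p i.+1 - p i)); last first.
  apply: eq_big_nat => i /andP[_ ik]; rewrite clip1 ?scale1r //.
  by rewrite lerBrDr (le_trans _ kt) // nat1r ler_nat.
rewrite telescope_sumr //; clearbody s.
by rewrite addrA addrCA subrr addr0 scalerBr scalerBl scale1r addrCA addrC.
Qed.

Lemma pl_segment n t : (0 < n)%N -> 0 <= t <= 1 -> exists k s,
  [/\ (k < n)%N, 0 <= s <= 1, k%:R <= n%:R * t <= k.+1%:R &
    forall p, pl n p t = (1 - s) *: p k + s *: p k.+1].
Proof.
move=> n0 /andP[t0 t1].
suff [k kn kt] : exists2 k, (k < n)%N & k%:R <= n%:R * t <= k.+1%:R.
  exists k, (n%:R * t - k%:R); split=> //; last by move=> p; exact: pl_at.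
  by rewrite subr_ge0 lerBlDr nat1r.
have nt0 : 0 <= n%:R * t by rewrite mulr_ge0.
have := truncn_itv nt0; set k := Num.truncn _ => /andP[k1 k2].
have [kn|nk] := ltnP k n; first by exists k => //; rewrite k1 ltW.
exists n.-1; first by rewrite ltn_predL.
rewrite prednK // ler_piMr // andbT (le_trans _ k1) // ler_nat.
exact: leq_trans (leq_pred _) nk.
Qed.

Lemma pl0 n p : pl n p 0 = p 0%N.
Proof.
rewrite /pl big1 ?addr0 // => i _; rewrite mulr0 sub0r clip0 ?scale0r //.
by rewrite oppr_le0.
Qed.

Lemma pl1 n p : pl n p 1 = p n.
Proof.
case: n => [|n]; first by rewrite /pl big_nil addr0.
rewrite (@pl_at _ _ _ n) // ?mulr1 ?lexx ?ler_nat ?leqnSn //.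
by rewrite -natr1 [_ - n%:R]addrC addKr subrr scale0r scale1r add0r.
Qed.

Definition cvx (C : set T) := forall a b s, C a -> C b -> 0 <= s <= 1 ->
  C ((1 - s) *: a + s *: b).

(** During each time step both paths run in a common convex part of [Omega], which contains the
    straight-line homotopy between them. *)
Lemma null_homotopic_move_vertices n p q x : p 0%N = x -> p n = x -> q 0%N = x ->
  (forall i, (i < n)%N -> exists C, [/\ cvx C, C `<=` Omega, C (p i) /\ C (p i.+1) &
     C (q i) /\ C (q i.+1)]) ->
  null_homotopic Omega x (pl n q) -> null_homotopic Omega x (pl n p).
Proof.
case: n => [|n] p0 pn q0 H.
  by rewrite (@eq_pl 0 p q) // => -[|i] // _; rewrite p0 q0.
apply: null_homotopic_straight; [exact: continuous_pl|exact: continuous_pl| | |].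
- by rewrite pl0.
- by rewrite pl1.
move=> s t s01 /(@pl_segment n.+1 t isT)[k [a [kn a01 _ plE]]].
have [C [cC CO [p1 p2] [q1 q2]]] := H _ kn.
by rewrite !plE; apply: CO; apply: (cC) => //; apply: cC.
Qed.


Definition seg (a b : T) : set T :=
  [set z | exists2 s, 0 <= s <= 1 & z = (1 - s) *: a + s *: b].

Lemma seg_cvx a b : cvx (seg a b).
Proof.
move=> _ _ s [c c01 ->] [d d01 ->] s01; exists ((1 - s) * c + s * d).
  by move: c01 d01 s01 => /andP[? ?] /andP[? ?] /andP[? ?]; apply/andP; split; nra.
rewrite !scalerDr !scalerA addrACA -!scalerDl; congr (_ *: _ + _ *: _); ring.
Qed.

Lemma segL a b : seg a b a.
Proof. by exists 0; rewrite ?lexx ?ler01 // subr0 scale1r scale0r addr0. Qed.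

Lemma segR a b : seg a b b.
Proof. by exists 1; rewrite ?lexx ?ler01 // subrr scale0r scale1r add0r. Qed.

Lemma cvx_seg C a b : cvx C -> C a -> C b -> seg a b `<=` C.
Proof. by move=> cC Ca Cb _ [s s01 ->]; exact: cC. Qed.

Definition emb (v : vtx) : T := (v.1%:~R, v.2%:~R).

Definition seg_in (a b : vtx) : Prop := seg (emb a) (emb b) `<=` Omega.

(** An arbitrary convex set covers both uses: a whole cell, and a single edge walked back and
    forth. *)
Definition flat (u v w v' : vtx) : Prop := exists C, [/\ cvx C, C `<=` Omega,
  C (emb u) /\ C (emb v) & C (emb w) /\ C (emb v')].

Section Loop.
Variable x : vtx.

Definition vert (l : seq vtx) i : T := emb (nth x l i).

(** Beyond its end a walk is continued by the default value [x]; the last condition also makes its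
    final vertex equal to [x]. *)
Definition loop_ok (l : seq vtx) := [/\ nth x l 0 = x,
  forall i, seg_in (nth x l i) (nth x l i.+1) &
  forall i, (size l <= i.+1)%N -> nth x l i = x].

(** Allowing every sufficiently large number of segments lets walks of different lengths be compared
    with the same [n]. *)
Definition null_loop l := forall n, (size l <= n.+1)%N ->
  null_homotopic Omega (emb x) (pl n (vert l)).

(* The loops have the same number [n] of segments: the repetition is moved to
   the end, one vertex at a time. *)
Lemma null_loop_stutter l1 u l2 : loop_ok (l1 ++ u :: u :: l2) ->
  loop_ok (l1 ++ u :: l2) /\
  (null_loop (l1 ++ u :: l2) -> null_loop (l1 ++ u :: u :: l2)).
Proof.
set l := l1 ++ u :: u :: l2; set l' := l1 ++ u :: l2; set k := size l1.
move=> [l0 lseg lend].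
have nl i : nth x l i = if (i <= k)%N then nth x l' i else nth x l' i.-1.
  rewrite !nth_cat -/k; case: (ltngtP i k) => [//|ki|->]; last by rewrite subnn.
  have [m ->] : exists m, i = (k + m.+1)%N by exists (i - k.+1)%N; lia.
  rewrite addKn addnS /= addKn ifN //; lia.
have nl' i : nth x l' i = if (i <= k)%N then nth x l i else nth x l i.+1.
  rewrite !nl; case: (leqP i k) => //= ki; rewrite ifN //; lia.
have sl : size l = (size l').+1 by rewrite !size_cat /= addnS.
have ok' : loop_ok l'.
  split; first by rewrite nl'.
    move=> i; rewrite !nl'; case: (ltngtP i k) => ik.
    - exact: lseg.
    - exact: lseg.
    - rewrite ik; have -> : nth x l k = nth x l k.+1; last exact: lseg.
      by rewrite !nl leqnn ifN //; lia.
  move=> i si; rewrite nl'; case: (leqP i k) => ik; last by apply: lend; rewrite sl.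
  have sk : (k < size l')%N by rewrite size_cat /= -/k; lia.
  have -> : i = k by lia.
  have -> : nth x l k = nth x l k.+1 by rewrite !nl leqnn ifN //; lia.
  by apply: lend; rewrite sl; lia.
split=> // nul n sn.
have sn' : (size l' <= n)%N by rewrite -ltnS -sl.
(* [q j] is [l'] with vertex [j] doubled: [q k] is [l], and [q n] agrees with [l'] up to index [n].
   Passing from [j] to [j.+1] moves one vertex along one edge of [l']. *)
pose q j i : T := if (i <= j)%N then vert l' i else vert l' i.-1.
have kn : (k <= n)%N by move: sn'; rewrite size_cat /= -/k; lia.
rewrite (@eq_pl n (vert l) (q k)); last by move=> i _; rewrite /q /vert nl; case: ifP.
have [l0' lseg' lend'] := ok'.
have: forall d j, (j <= n)%N -> n = (d + j)%N -> null_homotopic Omega (emb x) (pl n (q j)).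
  elim=> [|d IH] j jn nE.
    rewrite (@eq_pl n (q j) (vert l')); first by apply: nul; lia.
    by move=> i; rewrite /q nE add0n => ->.
  apply: (@null_homotopic_move_vertices n (q j) (q j.+1)).
  - by rewrite /q /vert l0'.
  - by rewrite /q ifN /vert ?lend' //; lia.
  - by rewrite /q /vert l0'.
  - move=> i ltin; pose m := if (i <= j)%N then i else i.-1.
    have : [/\ cvx (seg (vert l' m) (vert l' m.+1)), seg (vert l' m) (vert l' m.+1) `<=` Omega,
        seg (vert l' m) (vert l' m.+1) (vert l' m) &
        seg (vert l' m) (vert l' m.+1) (vert l' m.+1)].
      by split; [exact: seg_cvx|exact: lseg'|exact: segL|exact: segR].
    move=> Sm; exists (seg (vert l' m) (vert l' m.+1)); move: Sm.
    rewrite /q /m; have [ij|ji] := leqP i j.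
      rewrite (leq_trans ij) // ltnS ij; case: (ltnP i j) => ij' [c1 c2 c3 c4]; first by split.
      by split.
    case: i ji {ltin m} => // i ji.
    have [e1 e2 e3] : [/\ (i.+2 <= j)%N = false, (i.+2 <= j.+1)%N = false &
      (i.+1 <= j)%N = false] by split; lia.
    rewrite ?e1 ?e2 ?e3 /= => -[c1 c2 c3 c4].
    by case: (i.+1 <= j.+1)%N; split.
  - by apply: IH; lia.
by move=> /(_ (n - k)%N k kn); apply; lia.
Qed.

Lemma null_loop_move l1 u v w v' l2 : flat u v w v' -> loop_ok (l1 ++ u :: v :: w :: l2) ->
  loop_ok (l1 ++ u :: v' :: w :: l2) /\
  (null_loop (l1 ++ u :: v' :: w :: l2) -> null_loop (l1 ++ u :: v :: w :: l2)).
Proof.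
set l := l1 ++ u :: v :: w :: l2; set l' := l1 ++ u :: v' :: w :: l2; set k := size l1.
move=> [C [cC CO [Cu Cv] [Cw Cv']]] [l0 lseg lend].
have nk : nth x l k = u by rewrite nth_cat ltnn subnn.
have nk1 : nth x l k.+1 = v by rewrite nth_cat ltnNge leqnSn /= subSnn.
have nk2 : nth x l k.+2 = w by rewrite nth_cat ltnNge leqW //= -addn2 addKn.
have nl' i : nth x l' i = if i == k.+1 then v' else nth x l i.
  rewrite !nth_cat -/k; case: (ltnP i k) => ik; first by rewrite ifN //; lia.
  have [m ->] : exists m, i = (k + m)%N by exists (i - k)%N; lia.
  by rewrite addKn -addn1 eqn_add2l; case: m => [|[|m]].
have sl : size l' = size l by rewrite !size_cat.
have sk : (k.+2 < size l)%N by rewrite size_cat /= -/k; lia.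
have ok' : loop_ok l'.
  split; first by rewrite nl'.
    move=> i; rewrite !nl'; case: (i =P k.+1) => [->|ik].
      by rewrite ifN ?nk2; [exact: subset_trans (cvx_seg cC Cv' Cw) CO|lia].
    case: eqP => [[->]|_]; last exact: lseg.
    by rewrite nk; exact: subset_trans (cvx_seg cC Cu Cv') CO.
  by move=> i si; rewrite nl' ifN ?lend -?sl //; move: si; rewrite sl; lia.
split=> // nul n sn; have [l0' lseg' lend'] := ok'.
apply: (@null_homotopic_move_vertices n (vert l) (vert l')).
- by rewrite /vert l0.
- by rewrite /vert lend.
- by rewrite /vert l0'.
- move=> i ltin; rewrite /vert !nl'; case: (i =P k.+1) => [->|ik].
    rewrite ifN; last by lia.
    by exists C; split=> //; rewrite ?nk1 ?nk2.
  case: eqP => [[->]|_]; first by exists C; split=> //; rewrite ?nk ?nk1.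
  exists (seg (vert l i) (vert l i.+1)).
  by split; [exact: seg_cvx|exact: lseg|split; [exact: segL|exact: segR]..].
by apply: nul; rewrite sl.
Qed.

Lemma null_loop_reduces l : reduces flat l [:: x] -> loop_ok l -> null_loop l.
Proof.
suff H k k' : reduces flat k k' -> loop_ok k ->
    loop_ok k' /\ (null_loop k' -> null_loop k).
  move=> /H h /h[[_ /(_ 0%N) Ox _]]; apply => n _.
  rewrite (_ : pl n _ = fun=> emb x); first by apply: null_homotopic_cst; apply: Ox; exact: segL.
  apply/funext => t; rewrite (@eq_pl n _ (fun=> emb x)).
    by rewrite /pl big1 ?addr0 // => i _; rewrite subrr scaler0.
  by move=> [|i] _ //; rewrite /vert nth_default.
elim=> [//|a b c ab _ IH] oka.
suff [okb nab] : loop_ok b /\ (null_loop b -> null_loop a).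
  by have [okc nbc] := IH okb; split=> // /nbc/nab.
case: ab oka => [l1 u l2|l1 u v w v' l2 uv] oka; first exact: null_loop_stutter.
exact: null_loop_move.
Qed.

End Loop.

End PiecewiseLinear.

(** * Loops on the lattice *)

Section Fill.
Variables (R : realType).
Let T : normedModType R := (R * R)%type.
Variable Omega : set T.
Hypothesis fill : forall K : set T, compact K ->
  (forall z, K z -> Omega z \/ K^° z) -> K `<=` Omega.

Definition in_cell1 (i : int) (a : R) := i%:~R <= a <= (i + 1)%:~R.
Definition cell (c : vtx) : set T := [set z | in_cell1 c.1 z.1 /\ in_cell1 c.2 z.2].

Lemma cell_corner c a : corner c a -> cell c (emb R a).
Proof.
rewrite /corner /cell /in_cell1 /= !ler_int => /andP[h1 h2].
by split; lia.
Qed.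

Lemma in_cell1_cvx i (a b s : R) : in_cell1 i a -> in_cell1 i b -> 0 <= s <= 1 ->
  in_cell1 i ((1 - s) * a + s * b).
Proof.
rewrite /in_cell1 => /andP[a0 a1] /andP[b0 b1] /andP[s0 s1].
by apply/andP; split; nra.
Qed.

Lemma cell_cvx c : @cvx R (cell c).
Proof. by move=> a b s [a1 a2] [b1 b2] s01; split; exact: in_cell1_cvx. Qed.

Lemma compact_cell c : compact (cell c).
Proof.
rewrite (_ : cell c = `[c.1%:~R, (c.1 + 1)%:~R] `*` `[c.2%:~R, (c.2 + 1)%:~R]).
  by apply: compact_setX; exact: segment_compact.
by apply/seteqP; split=> z [z1 z2]; move: z1 z2; rewrite /= !in_itv /=.
Qed.

Definition cell_in (c : vtx) : Prop := cell c `<=` Omega.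

Definition lattice_edge (a b : vtx) : bool :=
  (ldist a b <= 1)%N && `[< seg_in Omega a b >].

Lemma lattice_edge_dist a b : lattice_edge a b -> (ldist a b <= 1)%N.
Proof. by case/andP. Qed.

Lemma flat_back u v : lattice_edge u v -> flat Omega u v u u.
Proof.
move=> /andP[_ /asboolP uv]; exists (seg (emb R u) (emb R v)).
by split=> //; [exact: seg_cvx|split; [exact: segL|exact: segR]|split; exact: segL].
Qed.

Lemma flat_cell c u v w v' : cell_in c ->
  [&& corner c u, corner c v, corner c w & corner c v'] -> flat Omega u v w v'.
Proof.
move=> cO /and4P[cu cv cw cv']; exists (cell c).
by split=> //; [exact: cell_cvx|split; exact: cell_corner..].
Qed.

Lemma edge_cell c u v : cell_in c -> corner c u -> corner c v ->
  (ldist u v <= 1)%N -> lattice_edge u v.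
Proof.
move=> cO cu cv uv; rewrite /lattice_edge uv; apply/asboolP.
by apply: subset_trans cO; apply: cvx_seg; [exact: cell_cvx|exact: cell_corner..].
Qed.

Lemma near_in_cell1 (a : R) : \forall b \near a, exists2 i, in_cell1 i a & in_cell1 i b.
Proof.
have /andP[fl fu] := floor_itv a; set f := Num.floor a in fl fu.
have [af|fa] := eqVneq a f%:~R.
  have : \forall b \near a, b \in `](f%:~R - 1), (f%:~R + 1)[.
    by apply: near_in_itvoo; rewrite in_itv /= af; apply/andP; split; lra.
  apply: filterS => b; rewrite in_itv /= => /andP[b1 b2].
  have [fb|bf] := leP f%:~R b.
    by exists f; rewrite /in_cell1 ?fl ?fb intrD; [rewrite af; lra|lra].
  exists (f - 1); rewrite /in_cell1 subrK intrB; [rewrite af; apply/andP; split; lra|].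
  by apply/andP; split; lra.
have : \forall b \near a, b \in `]f%:~R, (f + 1)%:~R[.
  by apply: near_in_itvoo; rewrite in_itv /= fu lt_neqAle eq_sym fa fl.
apply: filterS => b; rewrite in_itv /= => /andP[b1 b2].
by exists f; rewrite /in_cell1 ?fl ?(ltW fu) ?(ltW b1) ?(ltW b2).
Qed.

(** Consequently a union of cells that includes every cell through [z] is a neighbourhood of [z]. *)
Lemma near_cell (z : T) : \forall w \near z, exists2 c, cell c z & cell c w.
Proof.
have h1 : \forall w \near z, exists2 i, in_cell1 i z.1 & in_cell1 i w.1.
  exact: (cvg_fst (near_in_cell1 z.1)).
have h2 : \forall w \near z, exists2 i, in_cell1 i z.2 & in_cell1 i w.2.
  exact: (cvg_snd (near_in_cell1 z.2)).
near=> w.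
have [i iz iw] : exists2 i, in_cell1 i z.1 & in_cell1 i w.1 by near: w.
have [j jz jw] : exists2 i, in_cell1 i z.2 & in_cell1 i w.2 by near: w.
by exists (i, j).
Unshelve. all: by end_near. Qed.

Lemma in_cell1_seg j (y : R) (u v : int) : in_cell1 j y ->
  (u = j /\ v = j + 1) \/ (u = j + 1 /\ v = j) ->
  exists2 s, 0 <= s <= 1 & y = (1 - s) * u%:~R + s * v%:~R.
Proof.
rewrite /in_cell1 intrD => /andP[y0 y1] [[-> ->]|[-> ->]].
  by exists (y - j%:~R); [apply/andP; split; lra|rewrite intrD; ring].
by exists (j%:~R + 1 - y); [apply/andP; split; lra|rewrite intrD; ring].
Qed.

Lemma in_cell1_adj i (y : R) : in_cell1 i y -> in_cell1 (i + 1) y -> y = (i + 1)%:~R.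
Proof. by rewrite /in_cell1 => /andP[_ y1] /andP[y2 _]; apply/eqP; rewrite eq_le y1. Qed.

Lemma vertical_edge i j z : cell (i, j) z -> cell (i + 1, j) z ->
  (exists a b, [/\ lattice_edge a b, corner (i, j) a, corner (i, j) b,
    corner (i + 1, j) a & corner (i + 1, j) b] /\ a != b) -> Omega z.
Proof.
move=> [zi zj] [zi' _] [[a1 a2] [[b1 b2] [[/andP[_ /asboolP abO] ca cb da db] ab]]].
apply: abO; have z1 := in_cell1_adj zi zi'.
have [|s s01 z2] := @in_cell1_seg j z.2 a2 b2 zj.
  by move: ca cb da db ab; rewrite /corner xpair_eqE /=; clear; lia.
have [a1E b1E] : a1 = i + 1 /\ b1 = i + 1.
  by move: ca cb da db; rewrite /corner /=; clear; lia.
exists s => //; rewrite a1E b1E; case: z {zi zj zi'} z1 z2 => z1 z2 /= -> ->.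
by congr (_, _); rewrite /= -mulrDl subrK mul1r.
Qed.

Lemma horizontal_edge i j z : cell (i, j) z -> cell (i, j + 1) z ->
  (exists a b, [/\ lattice_edge a b, corner (i, j) a, corner (i, j) b,
    corner (i, j + 1) a & corner (i, j + 1) b] /\ a != b) -> Omega z.
Proof.
move=> [zi zj] [_ zj'] [[a1 a2] [[b1 b2] [[/andP[_ /asboolP abO] ca cb da db] ab]]].
apply: abO; have z2 := in_cell1_adj zj zj'.
have [|s s01 z1] := @in_cell1_seg i z.1 a1 b1 zi.
  by move: ca cb da db ab; rewrite /corner xpair_eqE /=; clear; lia.
have [a2E b2E] : a2 = j + 1 /\ b2 = j + 1.
  by move: ca cb da db; rewrite /corner /=; clear; lia.
exists s => //; rewrite a2E b2E; case: z {zi zj zj'} z1 z2 => z1 z2 /= -> ->.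
by congr (_, _); rewrite /= -mulrDl subrK mul1r.
Qed.

Lemma in_cell1_dist i i' (y : R) : in_cell1 i y -> in_cell1 i' y ->
  i' = i \/ i' = i + 1 \/ i = i' + 1.
Proof.
rewrite /in_cell1 => /andP[y0 y1] /andP[y2 y3].
have h1 : i <= i' + 1 by rewrite -(ler_int R) (le_trans y0).
have h2 : i' <= i + 1 by rewrite -(ler_int R) (le_trans y2).
lia.
Qed.

Lemma compact_enclosed x l : path lattice_edge x l -> last x l = x ->
  compact (\bigcup_(c in [set c | enclosed x l c]) cell c).
Proof.
move=> pl lx.
have [N hN] : exists N : nat, forall a, a \in x :: l -> (`|a.1| <= N)%N && (`|a.2| <= N)%N.
  elim: (x :: l) => [|b k [N hN]]; first by exists 0%N.
  exists (N + `|b.1| + `|b.2|)%N => a; rewrite in_cons => /predU1P[->|/hN /andP[a1 a2]].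
    by rewrite leq_addl andbT addnAC leq_addl.
  by rewrite -addnA !(leq_trans _ (leq_addr _ N)).
(* The [2 N + 3] integers from [- (N + 1)] to [N + 1]. *)
pose r := [seq i%:Z - N.+1%:Z | i <- iota 0 (2 * N + 3)].
have mr (i : int) : (`|i| <= N.+1)%N -> i \in r.
  move=> h; apply/mapP; exists (absz (i + N.+1%:Z)); last by clear -h; lia.
  by rewrite mem_iota; clear -h; lia.
pose s := [seq (i, j) | i <- r, j <- r].
rewrite (_ : \bigcup_(c in _) _ = \big[setU/set0]_(c <- s | enclosed x l c) cell c).
  by apply: bigsetU_compact => c _; exact: compact_cell.
rewrite -bigcup_seq_cond; congr (\bigcup_(c in _) _).
apply/seteqP; split=> c /=; last by case/andP.
move=> cE; rewrite cE andbT.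
have [c1 c2] := enclosed_bound (@lattice_edge_dist) pl lx hN cE.
case: c {cE} c1 c2 => i j c1 c2; apply/allpairsP; exists (i, j).
by split; rewrite ?mr // leqW.
Qed.

(** The filling property is applied to the union of the enclosed cells. A point all of whose cells
    are enclosed is interior to it; any other point of the union lies on an edge of the walk, hence
    in [Omega]. *)
Lemma enclosed_cell_in x l c : path lattice_edge x l -> last x l = x ->
  enclosed x l c -> cell_in c.
Proof.
move=> pl lx cE; apply: subset_trans (fill (compact_enclosed pl lx) _); first by move=> z cz; exists c.
move=> z [d dE dz]; have [all_enc|] := pselect (forall d', cell d' z -> enclosed x l d').
  right; have := near_cell z; rewrite /interior; apply: filterS => w [d' d'z d'w].
  by exists d' => //; exact: all_enc.
move=> /existsNP[[i' j'] /not_implyP[dz' /negP dE']]; left.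
case: d dE dz => i j dE dz.
(* The cells [(i, j)] and [(i', j')] may share only a corner. Passing through [(i', j)] yields two
   cells that contain [z], differ in parity and share a side. *)
have mz : cell (i', j) z by split; [exact: dz'.1|exact: dz.2].
have [mE|mE] := boolP (enclosed x l (i', j)).
  have [jE|[jE|jE]] : j' = j \/ j' = j + 1 \/ j = j' + 1 := in_cell1_dist dz.2 dz'.2.
  - by move: dE'; rewrite jE mE.
  - move: dz' dE'; rewrite /= jE => dz' dE'; apply: (horizontal_edge mz dz').
    by apply: (enclosed_vert _ pl); rewrite mE (negbTE dE').
  - move: mz mE; rewrite /= jE => mz mE; apply: (horizontal_edge dz' mz).
    by apply: (enclosed_vert _ pl); rewrite mE (negbTE dE').
have [iE|[iE|iE]] : i' = i \/ i' = i + 1 \/ i = i' + 1 := in_cell1_dist dz.1 dz'.1.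
- by move: mE; rewrite iE dE.
- move: mz mE; rewrite /= iE => mz mE; apply: (vertical_edge dz mz).
  by apply: (enclosed_horiz lattice_edge_dist _ pl lx); rewrite dE (negbTE mE).
- move: dz dE; rewrite /= iE => dz dE; apply: (vertical_edge mz dz).
  by apply: (enclosed_horiz lattice_edge_dist _ pl lx); rewrite dE (negbTE mE).
Qed.

Lemma lattice_null_loop x l : path lattice_edge x l -> last x l = x ->
  seg_in Omega x x -> null_loop Omega x (x :: l).
Proof.
move=> pl lx xx; apply: null_loop_reduces.
  exact: (closed_walk_reduces lattice_edge_dist flat_back flat_cell edge_cell enclosed_cell_in pl lx).
have lend i : (size (x :: l) <= i.+1)%N -> nth x (x :: l) i = x.
  rewrite leq_eqVlt => /predU1P[[<-]|si]; last by rewrite nth_default.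
  by rewrite -[size l]/((size (x :: l)).-1) nth_last.
split=> // i; have [li|il] := ltnP i (size l).
  by have /(pathP x)/(_ _ li)/andP[_ /asboolP] := pl.
by rewrite (lend i il) (lend i.+1 (leqW il)).
Qed.

End Fill.

(** * Rounding a loop to the lattice *)

Section Rounding.
Variables (R : realType).
Let T : normedModType R := (R * R)%type.

Definition box_close (r : R) (a b : T) := `|a.1 - b.1| < r /\ `|a.2 - b.2| < r.

Lemma close_uniform (f : R -> T) : continuous f -> exists N : nat,
  forall t t', 0 <= t <= 1 -> `|t - t'| <= N.+1%:R^-1 -> box_close 1 (f t) (f t').
Proof.
move=> cf; pose P (N : nat) t := forall t', `|t - t'| <= N.+1%:R^-1 -> box_close 1 (f t) (f t').
have : \forall N \near \oo, `[0, 1] `<=` P N.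
  have /compact_near_coveringP cov := @segment_compact R 0 1.
  apply: (cov nat \oo P) => t0 _.
  have c1 : {for t0, continuous (fun t => (f t).1)}.
    by apply: continuous_comp; [exact: cf|exact: cvg_fst].
  have c2 : {for t0, continuous (fun t => (f t).2)}.
    by apply: continuous_comp; [exact: cf|exact: cvg_snd].
  have h2 : 0 < (2^-1 : R) by rewrite invr_gt0.
  have near_t0 : \forall t \near t0, `|(f t0).1 - (f t).1| < 2^-1 /\ `|(f t0).2 - (f t).2| < 2^-1.
    have /cvgrPdist_lt/(_ _ h2) n1 := c1; have /cvgrPdist_lt/(_ _ h2) n2 := c2.
    by apply: filterS2 n1 n2 => t; split.
  have /nbhs_ballP[r /= r0 rP] := near_t0.
  exists ([set t | `|t0 - t| < r / 2], [set N : nat | N.+1%:R^-1 < r / 2]).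
    split => /=.
      by apply/nbhs_ballP; exists (r / 2); [rewrite /= divr_gt0|move=> t].
    exists (Num.truncn (2 / r)) => // N /= MN.
    rewrite -[r / 2]invrK ltf_pV2 ?posrE ?invr_gt0 ?divr_gt0 // invf_div.
    by apply: lt_le_trans (truncnS_gt _) _; rewrite ler_nat ltnS.
  move=> [t N] [/= tr Nr] t' tt'.
  have tN := le_lt_trans tt' Nr.
  have [|a1 a2] := rP t; first by rewrite -ball_normE /=; lra.
  have [|b1 b2] := rP t'.
    rewrite -ball_normE /=; apply: le_lt_trans (ler_distD t _ _) _.
    by rewrite [ltRHS]splitr ltrD.
  split; [apply: le_lt_trans (ler_distD ((f t0).1) _ _) _|apply: le_lt_trans (ler_distD ((f t0).2) _ _) _]; rewrite distrC; lra.
move=> [N _ NP]; exists N => t t' t01 tt'; by apply: (NP N) => //=.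
Qed.

Lemma floor_dist (a b : R) : `|a - b| < 1 -> (`|Num.floor a - Num.floor b| <= 1)%N.
Proof.
have /andP[a1 a2] := floor_itv a; have /andP[b1 b2] := floor_itv b.
rewrite ltr_distl => /andP[ab ba]; move: a2 b2; rewrite !intrD => a2 b2.
have h1 : Num.floor a < Num.floor b + 2 by rewrite -(ltr_int R) intrD; lra.
have h2 : Num.floor b < Num.floor a + 2 by rewrite -(ltr_int R) intrD; lra.
by move: h1 h2; move: (Num.floor a) (Num.floor b) => u v; lia.
Qed.

Lemma floor_close (a b : R) : `|a - b| < 1 -> `|a - (Num.floor b)%:~R| < 2.
Proof.
have /andP[b1 b2] := floor_itv b; rewrite intrD in b2.
by rewrite !ltr_distl => /andP[ab ba]; apply/andP; split; lra.
Qed.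

Lemma lt_convex (m a b s : R) : m < a -> m < b -> 0 <= s <= 1 -> m < (1 - s) * a + s * b.
Proof.
move=> ma mb /andP[]; rewrite le_eqVlt => /predU1P[<- _|s0 s1]; first by rewrite subr0; lra.
have h1 : s * m < s * b by rewrite ltr_pM2l.
have h2 : (1 - s) * m <= (1 - s) * a by rewrite ler_wpM2l ?subr_ge0 // ltW.
lra.
Qed.

Lemma close_cvx r c : cvx (box_close r c).
Proof.
move=> a b s [a1 a2] [b1 b2] s01; move: a1 a2 b1 b2.
rewrite /box_close !ltr_distlC => /andP[? ?] /andP[? ?] /andP[? ?] /andP[? ?] /=.
have h (m u v : R) : u < m -> v < m -> (1 - s) * u + s * v < m.
  move=> um vm; rewrite -ltrN2 opprD -!mulrN; apply: lt_convex => //; by rewrite ltrN2.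
by split; apply/andP; split; [exact: lt_convex|exact: h|exact: lt_convex|exact: h].
Qed.

Variable Omega : set T.
Hypothesis fill : forall K : set T, compact K ->
  (forall z, K z -> Omega z \/ K^° z) -> K `<=` Omega.

Section Loop.
Variables (f : R -> T) (N : nat).
Hypothesis cf : continuous f.
Hypothesis f0 : f 0 = 0.
Hypothesis f1 : f 1 = 0.
Hypothesis fO : forall t, 0 <= t <= 1 -> box_close 4 (f t) `<=` Omega.
Hypothesis fN : forall t t', 0 <= t <= 1 -> `|t - t'| <= N.+1%:R^-1 -> box_close 1 (f t) (f t').

Let n := N.+1.*2.
Let node k : T := f (k%:R / n%:R).
(** At even [m] both coordinates are read at node [m]; at odd [m] the first is read at the next node
    and the second at the previous one. Thus each step changes a single coordinate. *)
Definition round m : vtx :=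
  (Num.floor (node (uphalf m).*2).1, Num.floor (node m./2.*2).2).

Let n0 : 0 < n%:R :> R. Proof. by rewrite ltr0n. Qed.
Let nE : N.+1%:R^-1 = 2 / n%:R :> R.
Proof. by rewrite /n -muln2 natrM invfM mulrCA divff ?mulr1 ?pnatr_eq0. Qed.

Lemma close_node t k m : 0 <= t <= 1 -> m%:R <= n%:R * t <= m.+1%:R ->
  (m <= k.+1)%N -> (k <= m.+2)%N -> box_close 1 (f t) (node k).
Proof.
move=> t01 /andP[t1 t2] mk km; apply: fN => //; rewrite nE ler_norml.
have k1 : k%:R <= m%:R + 2 :> R by rewrite -natrD ler_nat addn2.
have k2 : m%:R <= k%:R + 1 :> R by rewrite natr1 ler_nat.
rewrite -natr1 in t2.
have -> : t = n%:R * t / n%:R by rewrite mulrC mulKf ?gt_eqF.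
rewrite -mulrBl -mulNr !ler_pM2r ?invr_gt0 //.
by apply/andP; split; lra.
Qed.

(** The radius 2 allows 1 for the move to a node and 1 for the floor. *)
Lemma close_round t m q : (m < n)%N -> 0 <= t <= 1 -> m%:R <= n%:R * t <= m.+1%:R ->
  (q == m) || (q == m.+1) -> box_close 2 (f t) (emb R (round q)).
Proof.
move=> mn t01 tm qm.
have [|| c1 _] := @close_node t (uphalf q).*2 m t01 tm.
- by move: qm => /orP[] /eqP ->; lia.
- by move: qm => /orP[] /eqP ->; lia.
have [|| _ c2] := @close_node t q./2.*2 m t01 tm.
- by move: qm => /orP[] /eqP ->; lia.
- by move: qm => /orP[] /eqP ->; lia.
by split; apply: floor_close.
Qed.

Lemma lattice_edge_round m : (m < n)%N -> lattice_edge Omega (round m) (round m.+1).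
Proof.
move=> mn; have t01 : 0 <= (m%:R / n%:R : R) <= 1.
  by rewrite divr_ge0 //= ler_pdivrMr // mul1r ler_nat ltnW.
have tm : m%:R <= n%:R * (m%:R / n%:R : R) <= m.+1%:R.
  by rewrite mulrC divfK ?gt_eqF // lexx ler_nat leqnSn.
apply/andP; split; last first.
  apply/asboolP; apply: subset_trans (fO t01); apply: cvx_seg; first exact: close_cvx.
    have [|c1 c2] := close_round (q := m) mn t01 tm; first by rewrite eqxx.
    by split; [apply: lt_trans c1 _|apply: lt_trans c2 _]; rewrite ltr_nat.
  have [|c1 c2] := close_round (q := m.+1) mn t01 tm; first by rewrite eqxx orbT.
  by split; [apply: lt_trans c1 _|apply: lt_trans c2 _]; rewrite ltr_nat.
have node_close k : (k.+2 <= n)%N -> box_close 1 (node k) (node k.+2).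
  move=> kn; apply: fN.
    by rewrite divr_ge0 //= ler_pdivrMr // mul1r ler_nat (leq_trans _ kn) // leqW.
  rewrite nE -mulrBl -[k.+2]addn2 natrD opprD addrA subrr sub0r mulNr normrN.
  by rewrite ger0_norm ?divr_ge0.
have En j : (j.*2 < n)%N -> (j.*2.+2 <= n)%N by rewrite /n; lia.
have [j [mE|mE]] : exists j, m = j.*2 \/ m = j.*2.+1.
- by exists m./2; lia.
- have [e1 e2 e3 e4] : [/\ uphalf j.*2 = j, uphalf j.*2.+1 = j.+1, j.*2./2 = j &
    j.*2.+1./2 = j] by split; lia.
  have [|c1 _] := node_close j.*2; first by rewrite En // -mE.
  rewrite /ldist /round mE e1 e2 e3 e4 /= subrr absz0 addn0 doubleS.
  exact: floor_dist.
- have [e1 e2 e3 e4] : [/\ uphalf j.*2.+1 = j.+1, uphalf j.*2.+2 = j.+1, j.*2.+1./2 = j &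
    j.*2.+2./2 = j.+1] by split; lia.
  have [|_ c2] := node_close j.*2; first by rewrite En // -ltnS -mE ltnW.
  rewrite /ldist /round mE e1 e2 e3 e4 /= subrr absz0 add0n doubleS.
  exact: floor_dist.
Qed.

Lemma round0 : round 0 = (0, 0).
Proof. by rewrite /round /= /node mul0r f0 /= floor0. Qed.

Lemma round_last : round n = (0, 0).
Proof.
rewrite /round /n uphalf_double doubleK -/n /node divff ?gt_eqF // f1 /=.
by rewrite floor0.
Qed.

(** At each time the loop and its rounded polygon lie in the same convex box inside [Omega], so a
    straight-line homotopy joins them; the polygon is a closed lattice walk and contracts. *)
Lemma null_homotopic_round : null_homotopic Omega 0 f.
Proof.
pose l := mkseq (fun m => round m.+1) n.
have nthl m : (m <= n)%N -> nth (0, 0) ((0, 0) :: l) m = round m.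
  by case: m => [|m] mn; rewrite ?round0 //= nth_mkseq.
have lpath : path (lattice_edge Omega) (0, 0) l.
  apply/(pathP (0, 0)) => m; rewrite size_mkseq => mn.
  have := lattice_edge_round mn; rewrite -(nthl m (ltnW mn)) -(nthl m.+1 mn); exact.
have ll : last (0, 0) l = (0, 0).
  by rewrite (last_nth (0, 0)) size_mkseq nthl // round_last.
have O0 : Omega 0.
  have t0 : 0 <= (0 : R) <= 1 by rewrite lexx ler01.
  by apply: (fO t0); rewrite f0; split; rewrite subrr normr0.
have xx : seg_in Omega (0, 0) (0, 0).
  by move=> _ [s _ ->]; rewrite -scalerDl subrK scale1r.
have nul := lattice_null_loop fill lpath ll xx.
have {}nul : null_homotopic Omega 0 (pl n (vert R (0, 0) ((0, 0) :: l))).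
  have sl : size l = n by rewrite /l size_mkseq.
  by apply: nul; rewrite -[size _]/((size l).+1) sl.
apply: (null_homotopic_straight cf _ f0 f1 _ nul); first exact: continuous_pl.
move=> s t s01 t01; have [k [a [kn a01 kt plE]]] := @pl_segment R n t isT t01.
rewrite plE; apply: (fO t01); apply: close_cvx => //.
  by split; rewrite subrr normr0.
have vk m : (m == k) || (m == k.+1) -> box_close 4 (f t) (vert R (0, 0) ((0, 0) :: l) m).
  move=> mk; have mn : (m <= n)%N by case/orP: mk => /eqP -> //; exact: ltnW.
  rewrite /vert nthl //; have [c1 c2] := close_round kn t01 kt mk.
  by split; [apply: lt_trans c1 _|apply: lt_trans c2 _]; rewrite ltr_nat.
by apply: close_cvx => //; apply: vk; rewrite eqxx ?orbT.
Qed.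

End Loop.

End Rounding.

(** * Simply connected components *)

Section Plane.
Variable R : realType.
Local Notation T := (R * R)%type.
Local Notation C := (R[i]^o).

Lemma normc_le_add (z : R[i]) : `|z| <= (`|complex.Re z| + `|complex.Im z|)%:C%C.
Proof.
case: z => a b; rewrite normc_def lecR /=.
rewrite -[leRHS]ger0_norm ?addr_ge0 // -sqrtr_sqr ler_sqrt ?sqr_ge0 // sqrrD.
by rewrite !real_normK ?num_real // addrAC lerDl mulrn_wge0 // mulr_ge0.
Qed.

Lemma normc_ge_Im (z : R[i]) : `|complex.Im z|%:C%C <= `|z|.
Proof.
case: z => a b; rewrite normc_def lecR /= -sqrtr_sqr ler_sqrt ?addr_ge0 ?sqr_ge0 //.
by rewrite lerDr sqr_ge0.
Qed.

Lemma continuous_Re : continuous (@complex.Re R : C -> R).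
Proof.
move=> z; apply/(@cvgrPdist_lt R R C (nbhs z) (nbhs_filter z)) => e e0.
have e0' : 0 < e%:C%C by rewrite ltcR.
have : \forall w \near z, `|z - w| < e%:C%C.
  by apply/nbhs_ballP; exists e%:C%C => // w; rewrite -ball_normE.
apply: filterS => w zw; rewrite -ltcR; apply: le_lt_trans zw.
by rewrite -raddfB; exact: normc_ge_Re.
Qed.

Lemma continuous_Im : continuous (@complex.Im R : C -> R).
Proof.
move=> z; apply/(@cvgrPdist_lt R R C (nbhs z) (nbhs_filter z)) => e e0.
have e0' : 0 < e%:C%C by rewrite ltcR.
have : \forall w \near z, `|z - w| < e%:C%C.
  by apply/nbhs_ballP; exists e%:C%C => // w; rewrite -ball_normE.
apply: filterS => w zw; rewrite -ltcR; apply: le_lt_trans zw.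
by rewrite -raddfB; exact: normc_ge_Im.
Qed.

(** The lattice is kept integral; its mesh in the complex plane is the scale [r], and the base point
    [x] sits at the origin. *)
Definition chart (x : R[i]) (r : R) (w : T) : C := x + (r * w.1 +i* (r * w.2))%C.
Definition chart_inv (x : R[i]) (r : R) (z : C) : T :=
  (r^-1 * complex.Re (z - x), r^-1 * complex.Im (z - x)).

Lemma chartK x r : r != 0 -> cancel (chart x r) (chart_inv x r).
Proof.
by move=> r0 [a b]; rewrite /chart /chart_inv addrAC subrr add0r /= !mulKf.
Qed.

Lemma chart_invK x r : r != 0 -> cancel (chart_inv x r) (chart x r).
Proof.
move=> r0 z; rewrite /chart /chart_inv /= !mulrA divff // !mul1r.
by rewrite -[RHS](subrK (x : R[i])) addrC; congr (_ + _); case: (z - x).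
Qed.

Lemma continuous_chart_inv x r : continuous (chart_inv x r).
Proof.
have cB : continuous (fun z : C => (z - x : C)).
  by move=> z; apply: (@continuousB R[i] C C id (cst (x : C)) z);
    [exact: cvg_id|exact: cst_continuous].
have cM (g : C -> R) : continuous g -> continuous (fun z => r^-1 * g z).
  by move=> cg z; apply: (@continuousM R C (cst r^-1) g z); [exact: cst_continuous|exact: cg].
apply: continuous_pair; apply: cM; first exact: continuous_compose cB continuous_Re.
exact: continuous_compose cB continuous_Im.
Qed.

Lemma chart_sub x r v w : chart x r v - chart x r w =
  (r * (v.1 - w.1) +i* (r * (v.2 - w.2)))%C.
Proof.
rewrite /chart opprD addrACA subrr add0r; apply/eqP.
by rewrite eq_complex /= !mulrBr !eqxx.
Qed.

Lemma continuous_chart x r : continuous (chart x r).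
Proof.
move=> w; apply/(@cvgrPdist_lt R[i] C) => e /gt0_complex[d d0 ->].
pose g (v : T) : R := `|r * (w.1 - v.1)| + `|r * (w.2 - v.2)|.
have cg : continuous g.
  move=> v; apply: cvgD; apply: cvg_norm; apply: cvgM; try exact: cvg_cst.
    by apply: cvgB; [exact: cvg_cst|exact: cvg_fst].
  by apply: cvgB; [exact: cvg_cst|exact: cvg_snd].
have g0 : g w = 0 by rewrite /g !subrr !mulr0 normr0 addr0.
have := cg w; rewrite /continuous_at g0 => /cvgrPdist_lt/(_ d d0).
apply: filterS => v; rewrite sub0r normrN => gd.
apply: le_lt_trans (normc_le_add _) _; rewrite ltcR; apply: le_lt_trans gd.
apply: le_trans (ler_norm _); rewrite /g.
by rewrite chart_sub.
Qed.

(** A Lebesgue number for the compact image of the path, in terms of coordinates. *)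
Lemma near_path (f : R -> C) (Omega : set C) : continuous f -> open Omega ->
  (forall t, 0 <= t <= 1 -> Omega (f t)) ->
  exists2 d : R, 0 < d & forall t, 0 <= t <= 1 -> forall w : C,
    `|complex.Re (w - f t)| < d -> `|complex.Im (w - f t)| < d -> Omega w.
Proof.
move=> cf oO fO.
pose P (N : nat) t := forall w : C, `|f t - w| < (N.+1%:R^-1)%:C%C -> Omega w.
have : \forall N \near \oo, `[0, 1] `<=` P N.
  have /compact_near_coveringP cov := @segment_compact R 0 1.
  apply: (cov nat \oo P) => t0; rewrite /= in_itv /= => t01.
  have /nbhs_ballP[e /= /gt0_complex[d d0 ->] dO] : nbhs (f t0) Omega.
    by move: oO; rewrite openE; apply; exact: fO.
  have d2 : 0 < (d / 2)%:C%C by rewrite ltcR divr_gt0.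
  have ft0 : \forall t \near t0, `|f t0 - f t| < (d / 2)%:C%C.
    have /cvgrPdist_lt := cf t0; exact.
  exists ([set t | `|f t0 - f t| < (d / 2)%:C%C], [set N : nat | N.+1%:R^-1 < d / 2]).
    split=> //=; exists (Num.truncn (2 / d)) => // N /= MN.
    rewrite -[d / 2]invrK ltf_pV2 ?posrE ?invr_gt0 ?divr_gt0 // invf_div.
    by apply: lt_le_trans (truncnS_gt _) _; rewrite ler_nat ltnS.
  move=> [t N] [/= td Nd] w tw; apply: dO; rewrite -ball_normE /=.
  apply: le_lt_trans (ler_distD (f t) _ _) _.
  rewrite [d]splitr rmorphD; apply: ltrD => //.
  by apply: lt_trans tw _; rewrite ltcR.
(* Half the radius, since the modulus is at most [|Re| + |Im|]. *)
move=> [N _ NP]; exists (N.+1%:R^-1 / 2); first by rewrite divr_gt0 ?invr_gt0.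
move=> t t01 w w1 w2; apply: (NP N (leqnn N) t) => //.
by rewrite distrC; apply: le_lt_trans (normc_le_add _) _; rewrite ltcR [ltRHS]splitr ltrD.
Qed.

(** * Loops and components of an open set without holes *)

Variable Omega : set C.
Hypothesis openO : open Omega.
Hypothesis fillO : forall K : set C, compact K ->
  (forall z, K z -> Omega z \/ K^° z) -> K `<=` Omega.

Lemma chart_fill x r : r != 0 -> forall K : set T, compact K ->
  (forall w, K w -> (chart x r @^-1` Omega) w \/ K^° w) -> K `<=` chart x r @^-1` Omega.
Proof.
move=> r0 K cK KO w Kw; apply: (@fillO (chart x r @` K)); last by exists w.
  by apply: continuous_compact cK; apply: continuous_subspaceT; exact: continuous_chart.
move=> _ [v Kv <-]; have [|iv] := KO v Kv; [by left|right].
have cv := @continuous_chart_inv x r (chart x r v).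
have : nbhs (chart x r v) (chart_inv x r @^-1` K).
  by apply: cv; rewrite /= chartK.
by apply: filterS => z Kz; exists (chart_inv x r z) => //; rewrite chart_invK.
Qed.

Lemma loop_null_homotopic (f : R -> C) x : continuous f -> f 0 = x -> f 1 = x ->
  (forall t, 0 <= t <= 1 -> Omega (f t)) ->
  exists H : R * R -> C, [/\ continuous H,
    forall s t, s \in `[0, 1] -> t \in `[0, 1] -> Omega (H (s, t)),
    forall t, t \in `[0, 1] -> H (0, t) = f t,
    forall t, t \in `[0, 1] -> H (1, t) = x &
    forall s, s \in `[0, 1] -> H (s, 0) = x /\ H (s, 1) = x].
Proof.
move=> cf f0 f1 fO; have [d d0 dO] := near_path cf openO fO.
(* A box of radius 4 in the chart becomes one of radius [d]. *)
pose r := d / 4; have r_gt0 : 0 < r by rewrite divr_gt0.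
have r0 : r != 0 by rewrite gt_eqF.
pose phi := chart x r; pose psi := chart_inv x r.
pose g t : T := psi (f t).
have cg : continuous g by exact: continuous_compose cf (@continuous_chart_inv x r).
have psix : psi x = 0 by rewrite /psi /chart_inv subrr /= mulr0.
have gO t : 0 <= t <= 1 -> box_close 4 (g t) `<=` phi @^-1` Omega.
  move=> t01 w [w1 w2]; have fE : f t = chart x r (g t) by rewrite /g chart_invK.
  apply: (dO t t01); rewrite fE chart_sub; move: (g t) w1 w2 => u w1 w2 /=;
    by rewrite normrM gtr0_norm // -ltr_pdivlMl // distrC /r invf_div divfK ?gt_eqF.
have [N gN] := close_uniform cg.
have [H [cH HO H0 H1 Hx]] : null_homotopic (phi @^-1` Omega) 0 g.
  by apply: (null_homotopic_round (chart_fill r0) (N := N)) => //; rewrite /g ?f0 ?f1.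
have phi0 : phi 0 = x by rewrite -psix /phi /psi chart_invK.
exists (phi \o clip_homotopy H); split.
- by apply: continuous_compose (@continuous_chart x r); exact: continuous_clip_homotopy.
- by move=> s t _ _; apply: HO; rewrite in_itv /= clip_itv.
- move=> t t01; have t1 := t01; rewrite in_itv /= in t1.
  by rewrite /= /clip_homotopy /= (clip0 (lexx 0)) (clip_id t1) H0 //; exact: (chart_invK x r0).
- move=> t t01; have t1 := t01; rewrite in_itv /= in t1.
  by rewrite /= /clip_homotopy /= (clip1 (lexx 1)) (clip_id t1) H1.
- move=> s s01; have s1 := s01; rewrite in_itv /= in s1.
  rewrite /= /clip_homotopy /= (clip0 (lexx 0)) (clip1 (lexx 1)) (clip_id s1).
  by have [-> ->] := Hx _ s01.
Qed.

Definition joined x y := exists f : R -> C, [/\ continuous f, f 0 = x, f 1 = y &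
  forall t, 0 <= t <= 1 -> Omega (f t)].

Lemma joined_segment x y z : joined x y ->
  (forall c : R, 0 <= c <= 1 -> Omega (y + c%:C%C * (z - y))) -> joined x z.
Proof.
move=> [f [cf f0 f1 fO]] yz.
exists (fun t => f (clip (2 * t)) + (clip (2 * t - 1))%:C%C * (z - y)); split.
- have c2 : continuous (fun t : R => 2 * t).
    by move=> t; apply: cvgM; [exact: cvg_cst|exact: cvg_id].
  have c21 : continuous (fun t : R => 2 * t - 1).
    by move=> t; apply: cvgB; [exact: c2|exact: cvg_cst].
  have cf2 := continuous_compose (continuous_compose c2 (@continuous_clip R)) cf.
  have cc := continuous_compose (continuous_compose c21 (@continuous_clip R)) (@continuous_real_complex R).
  move=> t; apply: (@continuousD R[i] C R); first exact: cf2.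
  by apply: (@continuousM R[i] R); [exact: cc|exact: cst_continuous].
- by rewrite mulr0 clip0 // sub0r clip0 ?lerN10 // mul0r addr0.
- have -> : 2 * 1 - 1 = 1 :> R by ring.
  by rewrite mulr1 !clip1 ?ler1n // f1 mul1r addrC subrK.
- move=> t t01; have [t2|t2] := leP (2 * t) 1.
    rewrite (@clip0 _ (2 * t - 1)) ?subr_le0 // mul0r addr0.
    by apply: fO; exact: clip_itv.
  by rewrite (@clip1 _ (2 * t)) ?ltW // f1; apply: yz; exact: clip_itv.
Qed.

Lemma joined_refl x : Omega x -> joined x x.
Proof. by move=> Ox; exists (fun=> x); split=> // t; exact: cst_continuous. Qed.

(** Balls are convex, so a path can be extended by a segment to or from any point of a ball inside
    [Omega]. *)
Lemma joined_ball x : open (joined x) /\ open (Omega `&` ~` joined x).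
Proof.
have seg_ball (y w1 w2 : C) (e : R[i]) (c : R) : ball y e w1 -> ball y e w2 -> 0 <= c <= 1 ->
    ball y e (w1 + c%:C%C * (w2 - w1)).
  rewrite -!ball_normE /= => h1 h2 /andP[c0 c1].
  rewrite (_ : y - _ = (1 - c)%:C%C * (y - w1) + c%:C%C * (y - w2)); last first.
    by rewrite rmorphB rmorph1; ring.
  apply: le_lt_trans (ler_normD _ _) _; rewrite !normrM.
  have c0' : 0 <= c%:C%C by rewrite lecR.
  have c1' : 0 <= (1 - c)%:C%C by rewrite lecR subr_ge0.
  rewrite (ger0_norm c0') (ger0_norm c1').
  move: c0; rewrite le_eqVlt => /predU1P[<-|c0].
    by rewrite mul0r addr0 subr0 mul1r.
  rewrite (_ : e = (1 - c)%:C%C * e + c%:C%C * e); last by rewrite rmorphB rmorph1; ring.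
  by rewrite ler_ltD // ?ler_wpM2l ?(ltW h1) // ltr_pM2l // ltcR.
split; rewrite openE => y.
  move=> xy; have Oy : Omega y by case: xy => f [_ _ <-]; apply; rewrite ler01 lexx.
  have /nbhs_ballP[e e0 eO] : nbhs y Omega by move: openO; rewrite openE; apply.
  apply/nbhs_ballP; exists e => // z yz; apply: (joined_segment xy) => c c01.
  by apply: eO; apply: seg_ball => //; exact: ballxx.
move=> [Oy xy]; have /nbhs_ballP[e e0 eO] : nbhs y Omega by move: openO; rewrite openE; apply.
apply/nbhs_ballP; exists e => // z yz; split; first exact: eO.
move=> xz; apply: xy; apply: (joined_segment xz) => c c01.
by apply: eO; apply: seg_ball => //; exact: ballxx.
Qed.

Lemma path_in_component (f : R -> C) t : continuous f ->
  (forall u, 0 <= u <= 1 -> Omega (f u)) -> 0 <= t <= 1 ->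
  connected_component Omega (f 0) (f t).
Proof.
move=> cf fO t01; apply: (@connected_component_max _ Omega (f @` `[0, 1])).
- by exists 0; rewrite //= in_itv /= lexx ler01.
- by move=> _ [u u01 <-]; apply: fO; rewrite /= in_itv in u01.
- apply: connected_continuous_connected; first exact: segment_connected.
  exact: continuous_subspaceT.
- by exists t; rewrite //= in_itv.
Qed.

Lemma component_joined x y : connected_component Omega x y -> joined x y.
Proof.
move=> xy; have Ox : Omega x.
  by apply: contrapT => nO; move: xy; rewrite connected_component_out.
have [oJ oC] := joined_ball x.
suff cE : connected_component Omega x `&` joined x = connected_component Omega x.
  by move: xy; rewrite -cE => -[].
apply: (@component_connected _ Omega x).
- by exists x; split; [exact: connected_component_refl|exact: joined_refl].
- by exists (joined x).
- exists (~` (Omega `&` ~` joined x)); first exact: open_closedC.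
  apply/seteqP; split=> z [cz jz]; split=> //; first by move=> [_].
  by apply: contrapT => nj; apply: jz; split=> //; exact: connected_component_sub cz.
Qed.

Theorem simply_connected_component x : Omega x ->
  simply_connected R (connected_component Omega x).
Proof.
move=> Ox; split.
- by exists x; exact: connected_component_refl.
- move=> y z xy xz; have yz : connected_component Omega y z.
    by rewrite -(same_connected_component xy).
  have [f [cf f0 f1 fO]] := component_joined yz.
  exists f; split=> // [|t]; first exact: continuous_subspaceT.
  rewrite in_itv /= (same_connected_component xy) -f0 => t01.
  exact: path_in_component.
move=> y f [cf f0 f1 fU].
have U0 : connected_component Omega x y by rewrite -f0; apply: fU; rewrite in_itv /= lexx ler01.
have fclip t : 0 <= t <= 1 -> f (clip t) = f t by move=> /clip_id ->.
have [|||| H [cH HO H0 H1 Hx]] := @loop_null_homotopic (f \o @clip R) y.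
- apply: (continuous_within_comp cf (@continuous_clip R)) => t.
  by rewrite /= in_itv /= clip_itv.
- by rewrite /= clip0.
- by rewrite /= clip1.
- move=> t t01; apply: (@connected_component_sub _ Omega x); apply: fU.
  by rewrite in_itv /= clip_itv.
exists H; split=> //.
- exact: continuous_subspaceT.
(* The homotopy is only known to stay in [Omega], but each stage is a path from the base point [y]
   and so remains in its component. *)
- move=> s t s01 t01; rewrite (same_connected_component U0) -(Hx s s01).1.
  apply: (@path_in_component (fun t => H (s, t))); last by rewrite in_itv in t01.
    apply: continuous_compose cH; apply: continuous_pair => u; [exact: cvg_cst|exact: cvg_id].
  by move=> u u01; apply: HO; rewrite // in_itv.
- by move=> t t01; rewrite H0 //= fclip // -in_itv.
Qed.

End Plane.

Theorem proposition4p3 (R : realType) (Delta : nat) (hDelta : (2 <= Delta)%N)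
    (U : set R[i]^o)
    (hU : exists2 lambda : R[i]^o, (~` zero_locus R Delta) lambda &
            U = connected_component (~` zero_locus R Delta) lambda) :
  simply_connected R U.
Proof.
case: hU => x Ox ->; apply: simply_connected_component => //.
  exact: closed_openC (@closed_closure _ _).
exact: zero_locusC_fill.
Qed.
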